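(* (ZF + DC + $\mathrm{AC}_{<\kappa}$, $\kappa>\aleph_0$) Suppose (a) $D$ is a $\kappa$-complete filter on a set $Y$; (b) $\bar\alpha=\langle\alpha_y:y\in Y\rangle\in{}^{Y}\mathrm{Ord}$; (c) $\delta:=\mathrm{rk}_D(\bar\alpha)$ satisfies $\mathrm{cf}(\delta)\ge\theta(\mathrm{Fil}^1_\kappa(Y))$, where $\mathrm{Fil}^1_\kappa(Y)$ is the set of $\kappa$-complete filters on $Y$. Then there is $D'$ such that ($\alpha$) $D'$ is a $\kappa$-complete filter on $Y$; ($\beta$) $D'\supseteq D$; ($\gamma$) $\prod\bar\alpha/D'$ has pseudo true cofinality; in fact, $\text{ps-tcf}(\prod\bar\alpha,<_{D'})=\mathrm{cf}(\mathrm{rk}_D(\bar\alpha))$.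
   Context: The base theory is ZF. $\mathrm{AC}_X$ says that every family of non-empty sets indexed by $X$ has a choice function; $\mathrm{AC}_{<\kappa}$ says that $\mathrm{AC}_\alpha$ holds for every $\alpha<\kappa$. Filters are proper; a filter is $\kappa$-complete if it is closed under intersections of fewer than $\kappa$ members. For a set $A$, $\theta(A)$ is the least (non-zero) ordinal $\alpha$ such that there is no function from $A$ onto $\alpha$. For a filter $D$ on $Y$ and $f,g:Y\to\mathrm{Ord}$, $f<_D g$ (also ''$f<g$ mod $D$'') means $\{s\in Y:f(s)<g(s)\}\in D$. The rank $\mathrm{rk}_D(f)$ is defined by recursion: for an ordinal $\alpha$, $\mathrm{rk}_D(f)=\alpha$ iff $\mathrm{rk}_D(f)\neq\beta$ for all $\beta<\alpha$ and for every $g:Y\to\mathrm{Ord}$ with $g<_D f$ there is $\beta<\alpha$ with $\mathrm{rk}_D(g)=\beta$ (under DC it is an ordinal when $D$ is $\aleph_1$-complete). Pseudo true cofinality: for a filter $D$ on $Y$ and $\bar\alpha\in{}^Y\mathrm{Ord}$, $\prod\bar\alpha/D$ (or $(\prod\bar\alpha,<_D)$) has pseudo true cofinality $\gamma$ when $\gamma$ is a limit ordinal and there is a sequence $\langle\mathcal F_\beta:\beta<\gamma\rangle$ such that: each $\mathcal F_\beta$ is a non-empty subset of $\{f\in{}^Y\mathrm{Ord}:f<_D\bar\alpha\}$; if $\beta_1<\beta_2<\gamma$, $f_1\in\mathcal F_{\beta_1}$, $f_2\in\mathcal F_{\beta_2}$ then $f_1<_D f_2$; and if $f\in{}^Y\mathrm{Ord}$,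 $f<_D\bar\alpha$, then for some $\beta<\gamma$ we have $f<_D g$ for all $g\in\mathcal F_\beta$. If such $\gamma$ exists, $\text{ps-tcf}(\prod\bar\alpha,<_D)$ denotes the minimal one. *)

(* Defs.v *)
(* The base theory is ZF without choice, so the claim is stated inside an
   arbitrary model of first-order ZF.  Separation and replacement are restricted
   to classes that are first-order definable with parameters: allowing all
   predicates of the metatheory would let metatheoretic choice yield the axiom
   of choice inside the model. *)

Record eps_struct : Type := EpsStruct {
  carrier :> Type;
  mem : carrier -> carrier -> Prop
}.

Arguments mem {_} _ _.

Declare Scope eps_scope.
Delimit Scope eps_scope with eps.
Open Scope eps_scope.
Notation "x ∈ y" := (mem x y) (at level 70, no associativity) : eps_scope.

(* Variables are de Bruijn indices. *)
Inductive formula : Type :=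
| Fmem (i j : nat)
| Feq (i j : nat)
| Fbot
| Fimp (phi psi : formula)
| Fall (phi : formula).

Definition scons {T : Type} (x : T) (e : nat -> T) (n : nat) : T :=
  match n with O => x | S m => e m end.

Fixpoint sat {M : eps_struct} (e : nat -> M) (phi : formula) : Prop :=
  match phi with
  | Fmem i j => e i ∈ e j
  | Feq i j => e i = e j
  | Fbot => False
  | Fimp phi psi => sat e phi -> sat e psi
  | Fall phi => forall x : M, sat (scons x e) phi
  end.

(* The assignment e supplies the parameters. *)
Definition definable1 {M : eps_struct} (P : M -> Prop) : Prop :=
  exists (phi : formula) (e : nat -> M),
    forall x, P x <-> sat (scons x e) phi.

Definition definable2 {M : eps_struct} (R : M -> M -> Prop) : Prop :=
  exists (phi : formula) (e : nat -> M),
    forall x y, R x y <-> sat (scons x (scons y e)) phi.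

Section Notions.
Context {M : eps_struct}.
Implicit Types x y z X Y Z A B D F f g h p : M.

Definition subset A B : Prop := forall x, x ∈ A -> x ∈ B.
Definition nonempty A : Prop := exists x, x ∈ A.

Definition is_upair z x y : Prop := forall t, t ∈ z <-> t = x \/ t = y.
(* Kuratowski's pair {{x}, {x, y}} *)
Definition is_pair p x y : Prop :=
  forall z, z ∈ p <-> is_upair z x x \/ is_upair z x y.
Definition is_succ z x : Prop := forall t, t ∈ z <-> t ∈ x \/ t = x.

Definition app f x y : Prop := exists p, is_pair p x y /\ p ∈ f.

Definition is_fun f X : Prop :=
  (forall p, p ∈ f -> exists x y, x ∈ X /\ is_pair p x y) /\
  (forall x, x ∈ X -> exists! y, app f x y).
Definition fun_to f X Z : Prop :=
  is_fun f X /\ forall x y, app f x y -> y ∈ Z.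
Definition onto f X Z : Prop :=
  fun_to f X Z /\ forall z, z ∈ Z -> exists x, app f x z.
Definition bij f X Z : Prop :=
  onto f X Z /\ forall x x' z, app f x z -> app f x' z -> x = x'.

(* Well-foundedness of membership on x comes from the axiom of foundation. *)
Definition is_ord x : Prop :=
  (forall y, y ∈ x -> subset y x) /\
  (forall y z, y ∈ x -> z ∈ x -> y ∈ z \/ y = z \/ z ∈ y).
Definition ord_le x y : Prop := x ∈ y \/ x = y.
Definition is_limit x : Prop :=
  is_ord x /\ nonempty x /\
  forall y, y ∈ x -> exists z, z ∈ x /\ y ∈ z.
Definition least_ord (P : M -> Prop) x : Prop :=
  is_ord x /\ P x /\ forall y, y ∈ x -> ~ P y.
Definition is_omega x : Prop := least_ord is_limit x.
Definition is_cardinal x : Prop :=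
  is_ord x /\ forall y, y ∈ x -> ~ exists h, bij h y x.

Definition AC X : Prop :=
  forall F, is_fun F X ->
  (forall x A, app F x A -> nonempty A) ->
  exists c, is_fun c X /\ forall x A y, app F x A -> app c x y -> y ∈ A.

Definition AC_lt (kappa : M) : Prop := forall a, a ∈ kappa -> AC a.

Definition small (kappa A : M) : Prop :=
  exists a h, a ∈ kappa /\ bij h a A.

Definition is_filter Y D : Prop :=
  (forall A, A ∈ D -> subset A Y) /\
  Y ∈ D /\
  (forall A, A ∈ D -> nonempty A) /\
  (forall A B, A ∈ D -> subset A B -> subset B Y -> B ∈ D) /\
  (forall A B C : M, A ∈ D -> B ∈ D ->
     (forall s, s ∈ C <-> s ∈ A /\ s ∈ B) -> C ∈ D).

Definition complete_filter (kappa Y D : M) : Prop :=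
  is_filter Y D /\
  forall A B, subset A D -> small kappa A ->
    (forall s, s ∈ B <-> s ∈ Y /\ forall C, C ∈ A -> s ∈ C) -> B ∈ D.

(* F = Fil^1_kappa(Y) *)
Definition is_Fil1 (kappa Y F : M) : Prop :=
  forall D, D ∈ F <-> complete_filter kappa Y D.

Definition is_theta A (t : M) : Prop :=
  least_ord (fun a => nonempty a /\ ~ exists h, onto h A a) t.

(* For delta = 0 and delta a successor this gives 0 and 1. *)
Definition is_cof (delta c : M) : Prop :=
  least_ord (fun b => exists h, fun_to h b delta /\
    forall x, x ∈ delta -> exists i y, app h i y /\ ord_le x y) c.

Definition ord_fun Y f : Prop :=
  is_fun f Y /\ forall s a, app f s a -> is_ord a.

Definition lt_mod Y D f g : Prop :=
  exists A, A ∈ D /\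
    forall s, s ∈ A <-> s ∈ Y /\ exists a b, app f s a /\ app g s b /\ a ∈ b.

Definition rank_recursion Y D (R : M -> M -> Prop) : Prop :=
  forall f a, ord_fun Y f -> is_ord a ->
    (R f a <->
     (forall b, b ∈ a -> ~ R f b) /\
     (forall g, ord_fun Y g -> lt_mod Y D g f -> exists b, b ∈ a /\ R g b)).

(* rk_D(f) = a.  The functions g in the recursion range over a proper class, so
   the rank is a class relation: the definable one satisfying the recursion.
   By induction on a, any two such classes agree on ord_fun Y and ordinals. *)
Definition is_rank Y D f (a : M) : Prop :=
  ord_fun Y f /\ is_ord a /\
  exists R, definable2 R /\ rank_recursion Y D R /\ R f a.

Definition has_pstcf Y D (alpha gamma : M) : Prop :=
  is_limit gamma /\
  exists F, is_fun F gamma /\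
    (forall b B, app F b B ->
       nonempty B /\ forall f, f ∈ B -> ord_fun Y f /\ lt_mod Y D f alpha) /\
    (forall b1 b2 B1 B2 f1 f2,
       b1 ∈ b2 -> app F b1 B1 -> app F b2 B2 -> f1 ∈ B1 -> f2 ∈ B2 ->
       lt_mod Y D f1 f2) /\
    (forall f, ord_fun Y f -> lt_mod Y D f alpha ->
       exists b B, app F b B /\ forall g, g ∈ B -> lt_mod Y D f g).

Definition is_pstcf Y D (alpha gamma : M) : Prop :=
  least_ord (has_pstcf Y D alpha) gamma.

End Notions.

Record ZF (M : eps_struct) : Prop := {
  zf_ext : forall x y : M, (forall z, z ∈ x <-> z ∈ y) -> x = y;
  zf_found : forall x : M, nonempty x ->
    exists y, y ∈ x /\ forall z, z ∈ y -> ~ z ∈ x;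
  zf_pair : forall x y : M, exists z, is_upair z x y;
  zf_union : forall x : M, exists u, forall z, z ∈ u <-> exists y, y ∈ x /\ z ∈ y;
  zf_power : forall x : M, exists p, forall z, z ∈ p <-> subset z x;
  zf_inf : exists x : M,
    (exists e, e ∈ x /\ ~ nonempty e) /\
    (forall y, y ∈ x -> exists z, z ∈ x /\ is_succ z y);
  zf_sep : forall P : M -> Prop, definable1 P ->
    forall a, exists b, forall x, x ∈ b <-> x ∈ a /\ P x;
  zf_repl : forall R : M -> M -> Prop, definable2 R ->
    forall a, (forall x y y', x ∈ a -> R x y -> R x y' -> y = y') ->
    exists b, forall y, y ∈ b <-> exists x, x ∈ a /\ R x y
}.

Definition DC (M : eps_struct) : Prop :=
  forall A r : M, nonempty A ->
  (forall x, x ∈ A -> exists y, y ∈ A /\ app r x y) ->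
  forall w : M, is_omega w ->
  exists s, fun_to s w A /\
    forall n m x y, n ∈ w -> is_succ m n -> app s n x -> app s m y -> app r x y.

(* Main.v *)
Require Import Defs.
From Stdlib Require Import Classical Arith.

(** Write [delta] for the rank of [alpha] with respect to [D], and let [W] be the
    set of all functions [f <= alpha].  The filter that works, called [E] below,
    consists of the sets [Z] for which some [f] in [W] still has the full rank
    [delta] although [f < alpha] almost everywhere (mod [D]) outside [Z].  It is
    dual to the ideal of the sets [B] such that [D + B] is improper or gives
    [alpha] a rank above [delta], but this description uses no filter but [D].

    [E] is a [kappa]-complete filter ([agreement_complete]).  This rests on
    [rank_cover]: if fewer than [kappa] functions are given and almost every
    value of [f] is at least the value of one of them, then one of them has rank
    at most that of [f].  Hence the pointwise minimum of fewer than [kappa]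
    functions in [W] of rank [delta] again has rank [delta].

    The heart of the proof is [dominated_ex]: for every [f] with [f < alpha] mod
    [E] there is [b] in [delta] such that [f < g] mod [E] for all [g] in [W] of
    rank at least [b].  Consider the functions [f'] in [W] that agree at each
    point with [f] or with [alpha].  If the rank of [f'] is below [delta], then
    [D] and the set where [f'] differs from [alpha] generate a
    [kappa]-complete filter, and this filter determines [f'] mod [D], hence
    determines the rank of [f'].  So the ranks below [delta] of such functions
    form an image of a subset of [Fil], and since the cofinality of [delta] is at
    least [theta], they have a bound [b] in [delta] ([pigeonhole],
    [selection_bound]).  Now let [g] in [W] have rank at least [b], and let [f']
    be [f] where [g <= f < alpha] and [alpha] elsewhere.  Then [g <= f'], so the
    rank of [f'] is at least [b], therefore it is [delta], and the set where
    [f' = alpha] belongs to [E].  On this set, [f < alpha] implies [f < g].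

    Consequently, functions whose ranks are sufficiently far apart are ordered
    mod [E] by their ranks, and those of large rank are cofinal.  A recursion
    of length [c], the cofinality of [delta], yields the levels of a pseudo
    scale ([pstcf_cof]); a pseudo scale of length less than [c] would give
    a cofinal map into [delta] that is too short ([pstcf_minimal]).

    Separation, replacement, induction and recursion inside the model apply only
    to first-order definable classes, so every class that is used has to be shown
    definable.  The first part derives this from the shape of the defining
    expression. *)

(** * Definability *)

Section Definability.
Context {M : eps_struct}.

Fixpoint rename (r : nat -> nat) (phi : formula) : formula :=
  match phi with
  | Fmem i j => Fmem (r i) (r j)
  | Feq i j => Feq (r i) (r j)
  | Fbot => Fbot
  | Fimp p q => Fimp (rename r p) (rename r q)
  | Fall p => Fall (rename (fun n => match n with O => O | S m => S (r m) end) p)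
  end.

Lemma sat_rename phi : forall r (e e' : nat -> M),
  (forall n, e' n = e (r n)) -> (sat e (rename r phi) <-> sat e' phi).
Proof.
  induction phi as [i j|i j| |p IHp q IHq|p IHp]; intros r e e' He; simpl.
  - rewrite !He; tauto.
  - rewrite !He; tauto.
  - tauto.
  - rewrite (IHp r e e' He), (IHq r e e' He); tauto.
  - split; intros H x.
    + apply (IHp (fun n => match n with O => O | S m => S (r m) end) (scons x e)).
      * intros [|n]; [reflexivity|apply He].
      * apply H.
    + apply (IHp (fun n => match n with O => O | S m => S (r m) end) (scons x e) (scons x e')).
      * intros [|n]; [reflexivity|apply He].
      * apply H.
Qed.

Lemma sat_pointwise phi (e e' : nat -> M) :
  (forall n, e n = e' n) -> (sat e phi <-> sat e' phi).
Proof.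
  intro H; rewrite <- (sat_rename phi (fun n => n) e e); [|reflexivity].
  apply sat_rename; intro n; symmetry; apply H.
Qed.

Definition look (v : nat -> M) (t : nat + M) : M :=
  match t with inl i => v i | inr a => a end.

(** A formula whose free variables are either variables of the environment or
    fixed parameters of the model.  Keeping the two apart leaves [dfn] closed
    under quantification over the variable [0], with no bookkeeping of the
    positions of the parameters. *)
Definition dfn (P : (nat -> M) -> Prop) : Prop :=
  exists (phi : formula) (rho : nat -> nat + M),
    forall v, P v <-> sat (fun n => look v (rho n)) phi.

(** The terms of the language: a variable, or a parameter. *)
Definition term (t : (nat -> M) -> M) : Prop :=
  exists u, forall v, t v = look v u.

Lemma term_var i : term (fun v => v i).
Proof. exists (inl i); reflexivity. Qed.

Lemma term_const a : term (fun _ => a).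
Proof. exists (inr a); reflexivity. Qed.

Lemma dfn_mem t u : term t -> term u -> dfn (fun v => t v ∈ u v).
Proof.
  intros [t' Ht] [u' Hu].
  exists (Fmem 0 1), (fun n => match n with O => t' | _ => u' end).
  intro v; simpl; rewrite Ht, Hu; tauto.
Qed.

Lemma dfn_eq t u : term t -> term u -> dfn (fun v => t v = u v).
Proof.
  intros [t' Ht] [u' Hu].
  exists (Feq 0 1), (fun n => match n with O => t' | _ => u' end).
  intro v; simpl; rewrite Ht, Hu; tauto.
Qed.

Lemma dfn_iff_congr P Q : (forall v, P v <-> Q v) -> dfn Q -> dfn P.
Proof.
  intros H (phi & rho & Hp); exists phi, rho; intro v; rewrite H; apply Hp.
Qed.

Lemma dfn_prop (P : Prop) : dfn (fun _ => P).
Proof.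
  destruct (classic P) as [H|H].
  - exists (Fimp Fbot Fbot), (fun n => inl n); intro v; simpl; tauto.
  - exists Fbot, (fun n => inl n); intro v; simpl; tauto.
Qed.

(** The variables of the two formulas are kept disjoint by renaming them to even
    and to odd indices. *)
Lemma dfn_imp P Q : dfn P -> dfn Q -> dfn (fun v => P v -> Q v).
Proof.
  intros (p & r & Hp) (q & s & Hq).
  exists (Fimp (rename (fun n => 2 * n) p) (rename (fun n => S (2 * n)) q)).
  exists (fun n => if Nat.even n then r (Nat.div2 n) else s (Nat.div2 n)).
  intro v; simpl.
  rewrite (sat_rename p _ _ (fun n => look v (r n))).
  2:{ intro n. replace (n + (n + 0)) with (2 * n) by (simpl; reflexivity).
      rewrite Nat.even_even, Nat.div2_even; reflexivity. }
  rewrite (sat_rename q _ _ (fun n => look v (s n))).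
  2:{ intro n.
      replace (S (n + (n + 0))) with (2 * n + 1) by (simpl; rewrite Nat.add_1_r; reflexivity).
      rewrite Nat.even_odd, Nat.div2_odd'; reflexivity. }
  rewrite <- Hp, <- Hq; tauto.
Qed.

(** The binder captures exactly the free variables of the formula that denote
    variable [0] of the environment; all others are shifted past it. *)
Lemma dfn_all (Q : (nat -> M) -> M -> Prop) :
  dfn (fun v => Q (fun n => v (S n)) (v 0)) -> dfn (fun v => forall x, Q v x).
Proof.
  intros (p & r & Hp).
  exists (Fall (rename (fun n => match r n with inl 0 => 0 | _ => S n end) p)).
  exists (fun n => match r n with inl (S i) => inl i | t => t end).
  intro v; simpl.
  assert (K : forall x, Q v x <->
    sat (scons x (fun n => look v (match r n with inl (S i) => inl i | t => t end)))
      (rename (fun n => match r n with inl 0 => 0 | _ => S n end) p)).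
  { intro x. rewrite (sat_rename p _ _ (fun n => look (scons x v) (r n))).
    - exact (Hp (scons x v)).
    - intro n; destruct (r n) as [[|i]|a] eqn:E; simpl; rewrite ?E; reflexivity. }
  split; intros H x; apply K, H.
Qed.

Lemma dfn_not P : dfn P -> dfn (fun v => ~ P v).
Proof. intro H; exact (dfn_imp _ _ H (dfn_prop False)). Qed.

Lemma dfn_and P Q : dfn P -> dfn Q -> dfn (fun v => P v /\ Q v).
Proof.
  intros HP HQ; apply (dfn_iff_congr _ (fun v => ~ (P v -> ~ Q v))).
  - intro v; split; [tauto|intro H; apply NNPP; tauto].
  - apply dfn_not, dfn_imp, dfn_not; assumption.
Qed.

Lemma dfn_or P Q : dfn P -> dfn Q -> dfn (fun v => P v \/ Q v).
Proof.
  intros HP HQ; apply (dfn_iff_congr _ (fun v => ~ P v -> Q v)).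
  - intro v; split; [tauto|intro H; destruct (classic (P v)); tauto].
  - apply dfn_imp; [apply dfn_not|]; assumption.
Qed.

Lemma dfn_iff P Q : dfn P -> dfn Q -> dfn (fun v => P v <-> Q v).
Proof.
  intros HP HQ; unfold iff; apply dfn_and; apply dfn_imp; assumption.
Qed.

Lemma dfn_ex (Q : (nat -> M) -> M -> Prop) :
  dfn (fun v => Q (fun n => v (S n)) (v 0)) -> dfn (fun v => exists x, Q v x).
Proof.
  intro H; apply (dfn_iff_congr _ (fun v => ~ forall x, ~ Q v x)).
  - intro v; split.
    + intros [x Hx] K; exact (K x Hx).
    + intro K; apply NNPP; intro N; apply K; intros x Hx; apply N; exists x; exact Hx.
  - apply dfn_not, (dfn_all (fun v x => ~ Q v x)), dfn_not; exact H.
Qed.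

Lemma dfn_def2 (R : M -> M -> Prop) t u :
  definable2 R -> term t -> term u -> dfn (fun v => R (t v) (u v)).
Proof.
  intros (p & e & H) [t' Ht] [u' Hu].
  exists p, (fun n => match n with 0 => t' | 1 => u' | S (S m) => inr (e m) end).
  intro v; rewrite H, Ht, Hu.
  apply sat_pointwise; intros [|[|n]]; reflexivity.
Qed.

Lemma dfn_def1 (P : M -> Prop) t : definable1 P -> term t -> dfn (fun v => P (t v)).
Proof.
  intros (p & e & H) [t' Ht].
  exists p, (fun n => match n with 0 => t' | S m => inr (e m) end).
  intro v; rewrite H, Ht.
  apply sat_pointwise; intros [|n]; reflexivity.
Qed.

Lemma dfn_definable1 (d : M) (P : M -> Prop) : dfn (fun v => P (v 0)) -> definable1 P.
Proof.
  intros (p & r & H).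
  exists (rename (fun n => match r n with inl 0 => 0 | _ => S n end) p),
    (fun n => match r n with inr a => a | _ => d end).
  intro x; rewrite (H (scons x (fun _ => d))); symmetry; apply sat_rename.
  intro n; destruct (r n) as [[|i]|a] eqn:E; simpl; rewrite ?E; reflexivity.
Qed.

Lemma dfn_definable2 (d : M) (R : M -> M -> Prop) :
  dfn (fun v => R (v 0) (v 1)) -> definable2 R.
Proof.
  intros (p & r & H).
  exists (rename (fun n => match r n with inl 0 => 0 | inl 1 => 1 | _ => S (S n) end) p),
    (fun n => match r n with inr a => a | _ => d end).
  intros x y; rewrite (H (scons x (scons y (fun _ => d)))); symmetry; apply sat_rename.
  intro n; destruct (r n) as [[|[|i]]|a] eqn:E; simpl; rewrite ?E; reflexivity.
Qed.

End Definability.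

(** Definitions in this database are unfolded when definability is checked. *)
Create HintDb dfndb.
#[export] Hint Unfold subset nonempty is_upair is_pair app is_fun fun_to is_ord ord_le
  least_ord ord_fun unique : dfndb.

Ltac dterm := first [apply term_var | apply term_const].
Ltac dstep :=
  cbv beta;
  first
  [ assumption
  | match goal with
    | |- dfn (fun v => _ ∈ _) => apply dfn_mem; dterm
    | |- dfn (fun v => _ = _) => apply dfn_eq; dterm
    | |- dfn (fun v => ?P) => apply (dfn_prop P)
    | |- dfn (fun v => @?P v <-> @?Q v) => apply (dfn_iff P Q)
    | |- dfn (fun v => @?P v /\ @?Q v) => apply (dfn_and P Q)
    | |- dfn (fun v => @?P v \/ @?Q v) => apply (dfn_or P Q)
    | |- dfn (fun v => ~ @?P v) => apply (dfn_not P)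
    | |- dfn (fun v => @?P v -> @?Q v) => apply (dfn_imp P Q)
    | |- dfn (fun v => exists x, @?Q v x) => apply (dfn_ex Q)
    | |- dfn (fun v => forall x, @?Q v x) => apply (dfn_all Q)
    | H : definable2 ?R |- dfn (fun v => ?R (@?t v) (@?u v)) =>
        apply (dfn_def2 R t u H); dterm
    | H : definable1 ?R |- dfn (fun v => ?R (@?t v)) =>
        apply (dfn_def1 R t H); dterm
    end
  | progress autounfold with dfndb ].
Ltac dsolve := repeat dstep.

(** * Sets, pairs and functions *)

Section SetTheory.
Context {M : eps_struct} (hZF : ZF M).
Implicit Types s t x y z X Y Z A B D F f g h p a b c : M.

Lemma definable1_intro (P : M -> Prop) : dfn (fun v => P (v 0)) -> definable1 P.
Proof. destruct (zf_inf _ hZF) as [d _]; apply (dfn_definable1 d). Qed.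

Lemma definable2_intro (R : M -> M -> Prop) :
  dfn (fun v => R (v 0) (v 1)) -> definable2 R.
Proof. destruct (zf_inf _ hZF) as [d _]; apply (dfn_definable2 d). Qed.

Ltac definable :=
  match goal with
  | |- definable1 _ => apply definable1_intro
  | |- definable2 _ => apply definable2_intro
  end; solve [dsolve].

Lemma ext x y : (forall z, z ∈ x <-> z ∈ y) -> x = y.
Proof. apply (zf_ext _ hZF). Qed.

Lemma sep (P : M -> Prop) A : definable1 P -> exists B, forall x, x ∈ B <-> x ∈ A /\ P x.
Proof. intro H; apply (zf_sep _ hZF P H). Qed.

Lemma image (G : M -> M -> Prop) A : definable2 G ->
  (forall x y y', x ∈ A -> G x y -> G x y' -> y = y') ->
  exists B, forall y, y ∈ B <-> exists x, x ∈ A /\ G x y.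
Proof. intro H; apply (zf_repl _ hZF G H). Qed.

Lemma mem_irrefl x : ~ x ∈ x.
Proof.
  intro H; destruct (zf_pair _ hZF x x) as [s Hs].
  destruct (zf_found _ hZF s) as (y & Hy & K); [exists x; apply Hs; tauto|].
  apply Hs in Hy; assert (y = x) by tauto; subst y.
  apply (K x H), Hs; tauto.
Qed.

Lemma mem_asym x y : x ∈ y -> ~ y ∈ x.
Proof.
  intros H H'; destruct (zf_pair _ hZF x y) as [s Hs].
  destruct (zf_found _ hZF s) as (z & Hz & K); [exists x; apply Hs; tauto|].
  apply Hs in Hz; destruct Hz; subst z.
  - apply (K y H'), Hs; tauto.
  - apply (K x H), Hs; tauto.
Qed.

Lemma upair_unique z z' x y : is_upair z x y -> is_upair z' x y -> z = z'.
Proof. intros H H'; apply ext; intro t; rewrite (H t), (H' t); tauto. Qed.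

Lemma pair_ex x y : exists p, is_pair p x y.
Proof.
  destruct (zf_pair _ hZF x x) as [s Hs], (zf_pair _ hZF x y) as [t Ht].
  destruct (zf_pair _ hZF s t) as [p Hp]; exists p; intro z; rewrite (Hp z); split.
  - intros [->| ->]; [left|right]; assumption.
  - intros [H|H]; [left|right]; eapply upair_unique; eassumption.
Qed.

Lemma pair_unique p q x y : is_pair p x y -> is_pair q x y -> p = q.
Proof. intros H H'; apply ext; intro t; rewrite (H t), (H' t); tauto. Qed.

Lemma pair_inj p x y x' y' : is_pair p x y -> is_pair p x' y' -> x = x' /\ y = y'.
Proof.
  intros H H'.
  destruct (zf_pair _ hZF x x) as [s Hs], (zf_pair _ hZF x y) as [t Ht],
    (zf_pair _ hZF x' y') as [t' Ht'].
  assert (Ks := proj1 (H' s) (proj2 (H s) (or_introl Hs))).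
  assert (Kt := proj1 (H' t) (proj2 (H t) (or_intror Ht))).
  assert (Kt' := proj1 (H t') (proj2 (H' t') (or_intror Ht'))).
  assert (x = x').
  { destruct Ks as [K|K]; generalize (proj2 (K x') (or_introl eq_refl));
      rewrite (Hs x'); intuition. }
  subst x'; split; [reflexivity|].
  assert (Y1 : y = x \/ y = y').
  { generalize (proj2 (Ht y) (or_intror eq_refl)).
    destruct Kt as [K|K]; rewrite (K y); intuition. }
  assert (Y2 : y' = x \/ y' = y).
  { generalize (proj2 (Ht' y') (or_intror eq_refl)).
    destruct Kt' as [K|K]; rewrite (K y'); intuition. }
  intuition congruence.
Qed.

Lemma app_func f X x y y' : is_fun f X -> app f x y -> app f x y' -> y = y'.
Proof.
  intros [H1 H2] H H'.
  assert (x ∈ X).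
  { destruct H as (p & Hp & Hf); destruct (H1 p Hf) as (x0 & y0 & Hx & Hp').
    destruct (pair_inj _ _ _ _ _ Hp Hp'); subst; assumption. }
  destruct (H2 x) as (y0 & _ & U); [assumption|].
  rewrite <- (U y H); apply U, H'.
Qed.

Lemma app_dom f X x y : is_fun f X -> app f x y -> x ∈ X.
Proof.
  intros [H1 H2] (p & Hp & Hf); destruct (H1 p Hf) as (x0 & y0 & Hx & Hp').
  destruct (pair_inj _ _ _ _ _ Hp Hp'); subst; assumption.
Qed.

Lemma app_ex f X x : is_fun f X -> x ∈ X -> exists y, app f x y.
Proof. intros [H1 H2] Hx; destruct (H2 x Hx) as (y & Hy & _); exists y; exact Hy. Qed.

Lemma fun_ext f g X : is_fun f X -> is_fun g X ->
  (forall x y, app f x y -> app g x y) -> f = g.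
Proof.
  intros Hf Hg H; apply ext; intro p; split; intro Hp.
  - destruct (proj1 Hf p Hp) as (x & y & Hx & Hxy).
    destruct (H x y) as (q & Hq & Hqg); [exists p; tauto|].
    rewrite (pair_unique _ _ _ _ Hxy Hq); exact Hqg.
  - destruct (proj1 Hg p Hp) as (x & y & Hx & Hxy).
    destruct (app_ex f X x Hf Hx) as [y' Hy'].
    assert (y = y') as <-.
    { apply (app_func g X x); [exact Hg|exists p; tauto|apply H, Hy']. }
    destruct Hy' as (q & Hq & Hqf); rewrite (pair_unique _ _ _ _ Hxy Hq); exact Hqf.
Qed.

Lemma fun_of_graph (G : M -> M -> Prop) X : definable2 G ->
  (forall x, x ∈ X -> exists y, G x y) ->
  (forall x y y', x ∈ X -> G x y -> G x y' -> y = y') ->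
  exists f, is_fun f X /\ forall x y, app f x y <-> x ∈ X /\ G x y.
Proof.
  intros HG He Hu.
  destruct (image (fun x p => exists y, G x y /\ is_pair p x y) X) as [f Hf].
  - definable.
  - intros x p p' Hx (y & Hy & Hp) (y' & Hy' & Hp').
    rewrite (Hu x y y' Hx Hy Hy') in Hp; eapply pair_unique; eassumption.
  - assert (Ha : forall x y, app f x y <-> x ∈ X /\ G x y).
    { intros x y; split.
      - intros (p & Hp & Hpf); apply Hf in Hpf; destruct Hpf as (x' & Hx & y' & Hy & Hp').
        destruct (pair_inj _ _ _ _ _ Hp Hp'); subst; tauto.
      - intros [Hx Hy]; destruct (pair_ex x y) as [p Hp]; exists p; split; [exact Hp|].
        apply Hf; exists x; split; [exact Hx|exists y; tauto]. }
    exists f; split; [split|exact Ha].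
    + intros p Hp; apply Hf in Hp; destruct Hp as (x & Hx & y & Hy & Hp); eauto.
    + intros x Hx; destruct (He x Hx) as [y Hy]; exists y; split.
      * apply Ha; tauto.
      * intros y' Hy'; apply Ha in Hy'; eapply Hu; [exact Hx|exact Hy|apply Hy'].
Qed.

(** * Ordinals *)

Lemma ord_elem a b : is_ord a -> b ∈ a -> is_ord b.
Proof.
  intros [T L] Hb; split.
  - intros y Hy z Hz.
    assert (y ∈ a) by (eapply T; eassumption).
    assert (z ∈ a) by (eapply T; eassumption).
    destruct (L z b) as [K|[K|K]]; auto.
    + subst z; destruct (mem_asym _ _ Hy Hz).
    + exfalso.
      destruct (sep (fun t => t = b \/ t = y \/ t = z) a) as [s Hs]; [definable|].
      destruct (zf_found _ hZF s) as (m & Hm & N); [exists b; apply Hs; tauto|].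
      apply Hs in Hm; destruct Hm as [_ [->|[->| ->]]].
      * apply (N y Hy), Hs; tauto.
      * apply (N z Hz), Hs; tauto.
      * apply (N b K), Hs; tauto.
  - intros y z Hy Hz; apply L; eapply T; eassumption.
Qed.

Lemma ord_trans a b c : is_ord c -> a ∈ b -> b ∈ c -> a ∈ c.
Proof. intros [T _] Ha Hb; eapply T; eassumption. Qed.

(** The least element of [b] outside [a] is equal to [a]. *)
Lemma ord_sub_le a b : is_ord a -> is_ord b -> subset a b -> ord_le a b.
Proof.
  intros Ha Hb S.
  destruct (sep (fun t => ~ t ∈ a) b) as [d Hd]; [definable|].
  destruct (classic (nonempty d)) as [N|N].
  - left; destruct (zf_found _ hZF d N) as (m & Hm & K).
    apply Hd in Hm; destruct Hm as [Hm Hma].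
    replace a with m; [exact Hm|]; apply ext; intro z; split; intro Hz.
    + apply NNPP; intro Hza; apply (K z Hz), Hd; split; [|exact Hza].
      eapply ord_trans; eassumption.
    + destruct (proj2 Hb z m) as [L|[L|L]]; auto.
      * subst z; contradiction.
      * destruct Hma; eapply ord_trans; eassumption.
  - right; apply ext; intro z; split; [apply S|].
    intro Hz; apply NNPP; intro Hza; apply N; exists z; apply Hd; tauto.
Qed.

(** The intersection of two ordinals is an ordinal, and if it differed from both,
    it would be an element of both, hence of itself. *)
Lemma ord_trichotomy a b : is_ord a -> is_ord b -> a ∈ b \/ a = b \/ b ∈ a.
Proof.
  intros Ha Hb.
  destruct (sep (fun t => t ∈ b) a) as [i Hi]; [definable|].
  assert (Oi : is_ord i).
  { split.
    - intros y Hy z Hz; apply Hi in Hy; apply Hi; split; eapply ord_trans; try apply Hz; tauto.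
    - intros y z Hy Hz; apply Hi in Hy, Hz; apply (proj2 Ha); tauto. }
  assert (Ia : ord_le i a) by (apply ord_sub_le; auto; intros t Ht; apply Hi, Ht).
  assert (Ib : ord_le i b) by (apply ord_sub_le; auto; intros t Ht; apply Hi, Ht).
  destruct Ia as [Ia|Ia], Ib as [Ib|Ib].
  - destruct (mem_irrefl i); apply Hi; tauto.
  - subst i; tauto.
  - subst i; tauto.
  - subst i; subst b; tauto.
Qed.

Lemma ord_le_or_mem a b : is_ord a -> is_ord b -> ord_le a b \/ b ∈ a.
Proof. intros Ha Hb; unfold ord_le; destruct (ord_trichotomy a b Ha Hb) as [?|[?|?]]; tauto. Qed.

Lemma ord_le_not_mem a b : ord_le a b -> ~ b ∈ a.
Proof.
  intros [H| ->]; [apply mem_asym, H|apply mem_irrefl].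
Qed.

Lemma ord_le_mem a b c : is_ord c -> ord_le a b -> b ∈ c -> a ∈ c.
Proof. intros Hc [H| ->]; [intro; eapply ord_trans; eassumption|auto]. Qed.

Lemma ord_mem_le a b c : is_ord c -> a ∈ b -> ord_le b c -> a ∈ c.
Proof. intros Hc H [K| <-]; [eapply ord_trans; eassumption|auto]. Qed.

Lemma ord_le_trans a b c : is_ord c -> ord_le a b -> ord_le b c -> ord_le a c.
Proof. intros Hc H [K| <-]; [left; eapply ord_le_mem; eassumption|auto]. Qed.

Lemma least_ord_ex (P : M -> Prop) a :
  definable1 P -> is_ord a -> P a -> exists m, least_ord P m /\ ord_le m a.
Proof.
  intros HP Ha Pa.
  destruct (classic (exists b, b ∈ a /\ P b)) as [N|N].
  - destruct (sep P a HP) as [s Hs].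
    destruct (zf_found _ hZF s) as (m & Hm & K).
    { destruct N as (b & Hb & Pb); exists b; apply Hs; tauto. }
    apply Hs in Hm; destruct Hm as [Hm Pm]; exists m; split; [split; [|split]|left; exact Hm].
    + eapply ord_elem; eassumption.
    + exact Pm.
    + intros y Hy Py; apply (K y Hy), Hs; split; [eapply ord_trans; eassumption|exact Py].
  - exists a; split; [split; [|split]|right; reflexivity]; auto.
    intros y Hy Py; apply N; eauto.
Qed.

Lemma least_ord_unique (P : M -> Prop) a b : least_ord P a -> least_ord P b -> a = b.
Proof.
  intros (Oa & Pa & La) (Ob & Pb & Lb).
  destruct (ord_trichotomy a b Oa Ob) as [K|[K|K]]; auto.
  - destruct (Lb a K Pa).
  - destruct (La b K Pb).
Qed.

Lemma ord_induction (P : M -> Prop) : definable1 P ->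
  (forall a, is_ord a -> (forall b, b ∈ a -> P b) -> P a) ->
  forall a, is_ord a -> P a.
Proof.
  intros HP H a Ha; apply NNPP; intro N.
  destruct (least_ord_ex (fun x => ~ P x) a) as (m & (Om & Nm & Lm) & _); auto.
  - definable.
  - apply Nm, H; auto. intros b Hb; apply NNPP; apply (Lm b Hb).
Qed.

Ltac ord_induct :=
  match goal with
  | |- forall i, is_ord i -> @?P i => apply (ord_induction P); [definable|cbv beta]
  end.

(** * Recursion and enumeration *)

Definition restr q p j : Prop := is_fun q j /\ forall k y, app q k y -> app p k y.

Lemma restr_ex p i j : is_fun p i -> subset j i -> exists q, restr q p j.
Proof.
  intros Hp S.
  destruct (fun_of_graph (fun k y => app p k y) j) as (q & Hq & Hqp).
  - definable.
  - intros k Hk; exact (app_ex p i k Hp (S k Hk)).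
  - intros k y y' _; exact (app_func p i k y y' Hp).
  - exists q; split; [exact Hq|]; intros k y H; apply Hqp in H; tauto.
Qed.

Lemma restr_app q p i j k y :
  is_fun p i -> restr q p j -> k ∈ j -> app p k y -> app q k y.
Proof.
  intros Hp [Hq H] Hk Hy.
  destruct (app_ex q j k Hq Hk) as [y' Hy'].
  rewrite (app_func p i k y y' Hp Hy (H _ _ Hy')); exact Hy'.
Qed.

(** A function on [i] that obeys the recursion in which [H] sends the restriction
    to [j] to the value at [j]. *)
Definition attempt (H : M -> M -> Prop) p i : Prop :=
  is_fun p i /\ forall j q y, j ∈ i -> restr q p j -> app p j y -> H q y.

Hint Unfold restr attempt : dfndb.

Lemma attempt_restr H p q i j :
  is_ord i -> attempt H p i -> j ∈ i -> restr q p j -> attempt H q j.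
Proof.
  intros Hi [Hp K] Hj [Hq R]; split; [exact Hq|].
  intros k r y Hk [Hr Rr] Hy; apply (K k).
  - eapply ord_trans; eassumption.
  - split; auto.
  - auto.
Qed.

Lemma attempt_unique H : definable2 H -> (forall p y y', H p y -> H p y' -> y = y') ->
  forall i, is_ord i -> forall p p', attempt H p i -> attempt H p' i -> p = p'.
Proof.
  intros HH Hu; ord_induct.
  intros i Hi IH p p' Hp Hp'; apply (fun_ext _ _ i (proj1 Hp) (proj1 Hp')).
  intros j y Hy.
  assert (Hj : j ∈ i) by exact (app_dom p i j y (proj1 Hp) Hy).
  assert (S : subset j i) by (intros k Hk; eapply ord_trans; eassumption).
  destruct (restr_ex p i j (proj1 Hp) S) as [q Hq].
  destruct (restr_ex p' i j (proj1 Hp') S) as [q' Hq'].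
  assert (q = q') as <-.
  { apply (IH j Hj); [apply (attempt_restr H p q i j)|apply (attempt_restr H p' q' i j)]; assumption. }
  destruct (app_ex p' i j (proj1 Hp') Hj) as [y' Hy'].
  rewrite (Hu q y y'); [exact Hy'| |].
  - eapply (proj2 Hp); eassumption.
  - eapply (proj2 Hp'); eassumption.
Qed.

Lemma ord_recursion H : definable2 H ->
  (forall p, exists y, H p y) -> (forall p y y', H p y -> H p y' -> y = y') ->
  forall i, is_ord i -> exists p, attempt H p i.
Proof.
  intros HH He Hu; ord_induct.
  intros i Hi IH.
  assert (U : forall j q q', j ∈ i -> attempt H q j -> attempt H q' j -> q = q').
  { intros j q q' Hj; apply attempt_unique; auto; eapply ord_elem; eassumption. }
  destruct (fun_of_graph (fun j y => exists q, attempt H q j /\ H q y) i) as (p & Hp & Hpa).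
  - definable.
  - intros j Hj; destruct (IH j Hj) as [q Hq]; destruct (He q) as [y Hy]; eauto.
  - intros j y y' Hj (q & Hq & Hy) (q' & Hq' & Hy').
    rewrite (U j q' q Hj Hq' Hq) in Hy'; eapply Hu; eassumption.
  - exists p; split; [exact Hp|].
    intros j r y Hj [Hr Rr] Hy; apply Hpa in Hy; destruct Hy as (_ & q & Hq & Hy).
    replace r with q; [exact Hy|]; symmetry.
    apply (fun_ext r q j Hr (proj1 Hq)); intros k z Hz.
    assert (Hk : k ∈ j) by exact (app_dom r j k z Hr Hz).
    assert (Oj : is_ord j) by (eapply ord_elem; eassumption).
    apply Rr, Hpa in Hz; destruct Hz as (Hki & q' & Hq' & Hz).
    destruct (app_ex q j k (proj1 Hq) Hk) as [z' Hz'].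
    destruct (restr_ex q j k (proj1 Hq)) as [s Hs].
    { intros t Ht; eapply ord_trans; eassumption. }
    assert (s = q') as <-.
    { apply (U k); auto; eapply attempt_restr; eassumption. }
    rewrite (Hu s z z' Hz); [exact Hz'|]; eapply (proj2 Hq); eassumption.
Qed.

(** The recursion takes at each step the least element of [X] that has not been
    used, and the value [a], which is not in [X], once [X] is exhausted.  The
    values in [X] are strictly increasing, hence at least their index; so [x] in
    [X] is used at step [x] at the latest, and [a] steps suffice. *)
Lemma enumeration X a : is_ord a -> subset X a ->
  exists xi h, is_ord xi /\ ord_le xi a /\ bij h xi X.
Proof.
  intros Ha HX.
  pose (new := fun p b => b ∈ X /\ forall j, ~ app p j b).
  pose (H := fun p y => least_ord (new p) y \/ (~ (exists b, new p b) /\ y = a)).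
  assert (dnew : forall p, definable1 (new p)) by (intro p; unfold new; definable).
  assert (HH : definable2 H) by (unfold H, new; definable).
  assert (OX : forall x, x ∈ X -> is_ord x).
  { intros x Hx; exact (ord_elem a x Ha (HX x Hx)). }
  destruct (ord_recursion H HH) with (i := a) as (E & HE & HEH); auto.
  { intro p; destruct (classic (exists b, new p b)) as [(b & Hb)|N].
    - destruct (least_ord_ex (new p) b) as (m & Hm & _); auto.
      + apply OX, Hb.
      + exists m; left; exact Hm.
    - exists a; right; auto. }
  { intros p y y' [L|[N ->]] [L'|[N' ->]]; auto.
    - eapply least_ord_unique; eassumption.
    - destruct N'; exists y; apply L.
    - destruct N; exists y'; apply L'. }
  pose (free := fun i b => b ∈ X /\ forall j, j ∈ i -> ~ app E j b).
  assert (HEf : forall i y, i ∈ a -> app E i y ->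
    least_ord (free i) y \/ (~ (exists b, free i b) /\ y = a)).
  { intros i y Hi Hy.
    destruct (restr_ex E a i HE) as [q Hq].
    { intros t Ht; eapply ord_trans; eassumption. }
    assert (K : forall b, new q b <-> free i b).
    { intro b; split; intros [Hb N]; split; auto.
      - intros j Hj Hjb; apply (N j); eapply restr_app; eassumption.
      - intros j Hjb; apply (N j); [exact (app_dom q i j b (proj1 Hq) Hjb)|].
        apply Hq, Hjb. }
    destruct (HEH i q y Hi Hq Hy) as [(O & L & N)|[N ->]].
    - left; split; [exact O|split; [apply K, L|]].
      intros b Hb Fb; apply (N b Hb), K, Fb.
    - right; split; [|reflexivity]; intros [b Hb]; apply N; exists b; apply K, Hb. }
  destruct (sep (fun i => exists y, app E i y /\ y ∈ X) a) as [xi Hxi]; [definable|].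
  assert (Hval : forall i y, i ∈ xi -> app E i y -> least_ord (free i) y).
  { intros i y Hi Hy; apply Hxi in Hi; destruct Hi as (Hi & y' & Hy' & HyX).
    rewrite (app_func E a i y' y HE Hy' Hy) in HyX.
    destruct (HEf i y Hi Hy) as [L|[_ ->]]; [exact L|].
    destruct (mem_irrefl a); auto. }
  assert (Hdown : forall i j, i ∈ xi -> j ∈ i -> j ∈ xi).
  { intros i j Hi Hj; pose proof (proj1 (proj1 (Hxi i) Hi)) as Hia.
    assert (Hja : j ∈ a) by (eapply ord_trans; eassumption).
    destruct (app_ex E a j HE Hja) as [y Hy].
    apply Hxi; split; [exact Hja|]; exists y; split; [exact Hy|].
    destruct (HEf j y Hja Hy) as [(_ & L & _)|[N _]]; [apply L|].
    destruct (app_ex E a i HE Hia) as [z Hz].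
    destruct (Hval i z Hi Hz) as (_ & (HzX & Fz) & _).
    destruct N; exists z; split; [exact HzX|].
    intros k Hk; apply Fz; refine (ord_trans _ _ _ _ Hk Hj); eapply ord_elem; eassumption. }
  assert (Hinc : forall i j y z, i ∈ xi -> j ∈ i -> app E i y -> app E j z -> z ∈ y).
  { intros i j y z Hi Hj Hy Hz.
    destruct (Hval i y Hi Hy) as (Oy & (HyX & Fy) & _).
    destruct (Hval j z (Hdown i j Hi Hj) Hz) as (Oz & (HzX & Fz) & Lz).
    destruct (ord_trichotomy z y Oz Oy) as [K|[K|K]]; [exact K| |].
    - subst z; destruct (Fy j Hj Hz).
    - destruct (Lz y K); split; [exact HyX|].
      intros k Hk; apply Fy; refine (ord_trans _ _ _ _ Hk Hj).
      apply Hxi in Hi; exact (ord_elem a i Ha (proj1 Hi)). }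
  assert (Oxi : is_ord xi).
  { split; [intros i Hi j Hj; eapply Hdown; eassumption|].
    intros i j Hi Hj; apply Hxi in Hi, Hj; apply (proj2 Ha); tauto. }
  assert (Hge : forall i, is_ord i -> i ∈ xi -> forall y, app E i y -> ord_le i y).
  { ord_induct.
    intros i Oi IH Hi y Hy.
    destruct (Hval i y Hi Hy) as (Oy & _).
    destruct (ord_le_or_mem i y Oi Oy) as [K|K]; [exact K|].
    assert (Hy' := Hdown i y Hi K).
    destruct (app_ex E a y HE) as [z Hz]; [apply Hxi, Hy'|].
    destruct (ord_le_not_mem y z (IH y K Hy' z Hz)).
    exact (Hinc i y y z Hi K Hy Hz). }
  destruct (restr_ex E a xi HE) as [h Hh]; [intros i Hi; apply Hxi, Hi|].
  exists xi, h; split; [exact Oxi|split; [|split; [split|]]].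
  - apply ord_sub_le; auto; intros i Hi; apply Hxi, Hi.
  - split; [apply Hh|].
    intros i y Hy; assert (Hi := app_dom h xi i y (proj1 Hh) Hy).
    apply Hval with (i := i); [exact Hi|apply Hh, Hy].
  - intros x Hx; apply NNPP; intro N.
    assert (Fx : forall i, i ∈ a -> free i x).
    { intros i Hi; split; [exact Hx|]; intros j Hj Hjx; apply N; exists j.
      apply (restr_app h E a xi); auto; apply Hxi; split.
      - eapply ord_trans; eassumption.
      - exists x; auto. }
    destruct (app_ex E a x HE (HX x Hx)) as [y Hy].
    assert (L : least_ord (free x) y).
    { destruct (HEf x y (HX x Hx) Hy) as [L|[NF _]]; [exact L|].
      destruct NF; exists x; apply Fx, HX, Hx. }
    assert (Hxx : x ∈ xi).
    { apply Hxi; split; [apply HX, Hx|]; exists y; split; [exact Hy|apply L]. }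
    destruct (Hge x (OX x Hx) Hxx y Hy) as [K|K].
    + apply L in K; apply K, Fx, HX, Hx.
    + subst y; apply N; exists x; eapply restr_app; eassumption.
  - intros i j z Hi Hj.
    assert (Hxi_i := app_dom h xi i z (proj1 Hh) Hi).
    assert (Hxi_j := app_dom h xi j z (proj1 Hh) Hj).
    apply Hh in Hi, Hj.
    destruct (proj2 Oxi i j Hxi_i Hxi_j) as [K|[K|K]]; [|exact K|].
    + destruct (mem_irrefl z); exact (Hinc j i z z Hxi_j K Hj Hi).
    + destruct (mem_irrefl z); exact (Hinc i j z z Hxi_i K Hi Hj).
Qed.

(** The image is in bijection with the set of the least indices of its elements,
    and this set of ordinals is enumerated by an ordinal at most [a]. *)
Lemma small_image kappa a (G : M -> M -> Prop) B : is_ord kappa -> a ∈ kappa -> definable2 G ->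
  (forall i y y', i ∈ a -> G i y -> G i y' -> y = y') ->
  (forall y, y ∈ B <-> exists i, i ∈ a /\ G i y) -> small kappa B.
Proof.
  intros Hk Ha HG Gu HB.
  assert (Oa : is_ord a) by (eapply ord_elem; eassumption).
  (* the least index of each element of the image *)
  destruct (sep (fun i => exists y, G i y /\ forall j, j ∈ i -> ~ G j y) a) as [I HI];
    [definable|].
  destruct (enumeration I a Oa) as (xi & h & Oxi & Hle & Hh).
  { intros i Hi; apply HI, Hi. }
  destruct Hh as [[[Hh HhI] Hon] Hinj].
  destruct (fun_of_graph (fun k y => exists i, app h k i /\ G i y) xi) as (g & Hg & Hga).
  - definable.
  - intros k Hkx; destruct (app_ex h xi k Hh Hkx) as [i Hi].
    destruct (proj1 (HI i) (HhI k i Hi)) as (_ & y & Hy & _); eauto.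
  - intros k y y' Hkx (i & Hi & Hy) (i' & Hi' & Hy').
    rewrite (app_func h xi k i' i Hh Hi' Hi) in Hy'.
    apply (Gu i); auto; apply HI, (HhI k i Hi).
  - exists xi, g; split; [exact (ord_le_mem xi a kappa Hk Hle Ha)|].
    split; [split; [split; [exact Hg|]|]|].
    + intros k y Hy; apply Hga in Hy; destruct Hy as (_ & i & Hi & Hy).
      apply HB; exists i; split; [apply HI, (HhI k i Hi)|exact Hy].
    + intros y Hy; apply HB in Hy; destruct Hy as (i & Hi & Hy).
      destruct (least_ord_ex (fun i => i ∈ a /\ G i y) i) as (m & (Om & [Hma Hm] & L) & _).
      * definable.
      * exact (ord_elem a i Oa Hi).
      * auto.
      * destruct (Hon m) as [k Hkm].
        { apply HI; split; [exact Hma|]; exists y; split; [exact Hm|].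
          intros j Hj Hjy; apply (L j Hj); split; [exact (ord_trans j m a Oa Hj Hma)|exact Hjy]. }
        exists k; apply Hga; split; [exact (app_dom h xi k m Hh Hkm)|eauto].
    + intros k k' y Hy Hy'; apply Hga in Hy, Hy'.
      destruct Hy as (Hkx & i & Hi & Hy), Hy' as (Hkx' & i' & Hi' & Hy').
      destruct (proj1 (HI i) (HhI k i Hi)) as (Hia & z & Hz & L).
      destruct (proj1 (HI i') (HhI k' i' Hi')) as (Hia' & z' & Hz' & L').
      rewrite (Gu i z y Hia Hz Hy) in L; rewrite (Gu i' z' y Hia' Hz' Hy') in L'.
      apply (Hinj k k' i Hi); replace i with i'; [exact Hi'|].
      destruct (proj2 Oa i i' Hia Hia') as [K|[K|K]]; [|symmetry; exact K|].
      * destruct (L' i K Hy).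
      * destruct (L i' K Hy').
Qed.

Lemma binary_union x y : exists u, forall z, z ∈ u <-> z ∈ x \/ z ∈ y.
Proof.
  destruct (zf_pair _ hZF x y) as [p Hp], (zf_union _ hZF p) as [u Hu].
  exists u; intro z; rewrite (Hu z); split.
  - intros (t & Ht & Hz); apply Hp in Ht; destruct Ht; subst t; tauto.
  - intros [H|H]; [exists x|exists y]; split; auto; apply Hp; tauto.
Qed.

Lemma fun_space X Z : exists W, forall f, f ∈ W <-> fun_to f X Z.
Proof.
  destruct (binary_union X Z) as [V HV].
  destruct (zf_power _ hZF V) as [P1 H1], (zf_power _ hZF P1) as [P2 H2],
    (zf_power _ hZF P2) as [P3 H3].
  destruct (sep (fun f => fun_to f X Z) P3) as [W HW]; [definable|].
  exists W; intro f; rewrite (HW f); split; [tauto|intro H; split; [|exact H]].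
  apply H3; intros p Hp; apply H2; intros z Hz; apply H1; intros t Ht; apply HV.
  destruct H as [Hf HZ]; destruct (proj1 Hf p Hp) as (x & y & Hx & Hxy).
  assert (y ∈ Z) by (apply (HZ x y); exists p; auto).
  apply Hxy in Hz; destruct Hz as [Hz|Hz]; apply Hz in Ht; destruct Ht; subst t; auto.
Qed.

Lemma choose_family a W (Q : M -> M -> Prop) : AC a -> definable2 Q ->
  (forall i, i ∈ a -> exists g, g ∈ W /\ Q i g) ->
  exists phi, is_fun phi a /\ forall i g, app phi i g -> g ∈ W /\ Q i g.
Proof.
  intros HAC HQ H.
  destruct (fun_of_graph (fun i A => forall g, g ∈ A <-> g ∈ W /\ Q i g) a) as (F & HF & HFa).
  - definable.
  - intros i _; apply (sep (fun g => Q i g)); definable.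
  - intros i A A' _ HA HA'; apply ext; intro g; rewrite (HA g), (HA' g); tauto.
  - destruct (HAC F HF) as (phi & Hphi & K).
    + intros i A HA; apply HFa in HA; destruct HA as [Hi HA].
      destruct (H i Hi) as [g Hg]; exists g; apply HA, Hg.
    + exists phi; split; [exact Hphi|]; intros i g Hg.
      assert (Hi := app_dom phi a i g Hphi Hg).
      destruct (app_ex F a i HF Hi) as [A HA].
      apply (proj2 (proj1 (HFa i A) HA)), (K i A g HA Hg).
Qed.

(** * Properties that hold almost everywhere *)

Definition large D (P : M -> Prop) : Prop := exists A, A ∈ D /\ forall s, s ∈ A -> P s.
Definition lt_at f g s : Prop := exists x y, app f s x /\ app g s y /\ x ∈ y.
Definition le_at f g s : Prop := exists x y, app f s x /\ app g s y /\ ord_le x y.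
Definition le_mod D f g : Prop := large D (le_at f g).
Hint Unfold large lt_at le_at le_mod : dfndb.

Lemma large_impl D (P Q : M -> Prop) : (forall s, P s -> Q s) -> large D P -> large D Q.
Proof. intros H (A & HA & K); exists A; auto. Qed.

Lemma large_and Y D (P Q : M -> Prop) :
  is_filter Y D -> large D P -> large D Q -> large D (fun s => s ∈ Y /\ P s /\ Q s).
Proof.
  intros (HY & _ & _ & _ & HI) (A & HA & K) (B & HB & L).
  destruct (sep (fun s => s ∈ B) A) as [C HC]; [definable|].
  exists C; split; [exact (HI A B C HA HB HC)|].
  intros s Hs; apply HC in Hs; split; [apply (HY A HA); tauto|split; [apply K|apply L]; tauto].
Qed.

Lemma large_everywhere Y D (P : M -> Prop) :
  is_filter Y D -> (forall s, s ∈ Y -> P s) -> large D P.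
Proof. intros (_ & HY & _) H; exists Y; auto. Qed.

Lemma large_mem Y D (P : M -> Prop) A : is_filter Y D -> large D P ->
  subset A Y -> (forall s, s ∈ Y -> P s -> s ∈ A) -> A ∈ D.
Proof.
  intros (HY & _ & _ & HU & _) (B & HB & K) HA H.
  apply (HU B); auto; intros s Hs; apply H; [apply (HY B HB)|apply K]; exact Hs.
Qed.

Lemma large_inhabited Y D (P : M -> Prop) : is_filter Y D -> large D P -> exists s, s ∈ Y /\ P s.
Proof.
  intros (HY & _ & HN & _) (B & HB & K); destruct (HN B HB) as [s Hs].
  exists s; split; [apply (HY B HB)|apply K]; exact Hs.
Qed.

(** The set required by [lt_mod] is exactly the set of all points where the
    inequality holds; [large] only asks for a member of the filter inside it. *)
Lemma lt_mod_large Y D f g : is_filter Y D -> is_fun f Y ->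
  (lt_mod Y D f g <-> large D (lt_at f g)).
Proof.
  intros HD Hf; split.
  - intros (A & HA & K); exists A; split; [exact HA|]; intros s Hs; apply K, Hs.
  - intro H; destruct (sep (lt_at f g) Y) as [A HA]; [definable|].
    exists A; split; [|exact HA].
    apply (large_mem Y D (lt_at f g)); auto; intros s Hs; [apply HA, Hs|].
    intro K; apply HA; auto.
Qed.

Lemma large_inter kappa Y D a (P : M -> M -> Prop) :
  is_ord kappa -> complete_filter kappa Y D -> a ∈ kappa -> definable2 P ->
  (forall i, i ∈ a -> large D (P i)) -> large D (fun s => s ∈ Y /\ forall i, i ∈ a -> P i s).
Proof.
  intros Hk [HD HC] Ha HP H.
  pose (G := fun i A => forall s, s ∈ A <-> s ∈ Y /\ P i s).
  assert (HG : definable2 G) by (unfold G; definable).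
  assert (GU : forall i A A', i ∈ a -> G i A -> G i A' -> A = A').
  { intros i A A' _ K K'; apply ext; intro s; rewrite (K s), (K' s); tauto. }
  destruct (image G a HG GU) as [S HS].
  destruct (sep (fun s => forall C, C ∈ S -> s ∈ C) Y) as [B HB]; [definable|].
  exists B; split.
  - apply (HC S); auto.
    + intros A HA; apply HS in HA; destruct HA as (i & Hi & K).
      apply (large_mem Y D (P i)); auto; intros s Hs; [apply K, Hs|].
      intro Ps; apply K; auto.
    + apply (small_image kappa a G); auto.
  - intros s Hs; apply HB in Hs; destruct Hs as [Hs K]; split; [exact Hs|].
    intros i Hi; destruct (sep (P i) Y) as [A HA]; [definable|].
    apply HA, K, HS; exists i; auto.
Qed.

Lemma select Y f g (P : M -> Prop) : ord_fun Y f -> ord_fun Y g -> definable1 P ->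
  exists h, ord_fun Y h /\
    forall s x, app h s x <-> s ∈ Y /\ (P s /\ app f s x \/ ~ P s /\ app g s x).
Proof.
  intros [Hf Of] [Hg Og] HP.
  destruct (fun_of_graph (fun s x => P s /\ app f s x \/ ~ P s /\ app g s x) Y)
    as (h & Hh & K).
  - definable.
  - intros s Hs; destruct (app_ex f Y s Hf Hs) as [x Hx], (app_ex g Y s Hg Hs) as [y Hy].
    destruct (classic (P s)); eauto.
  - intros s x x' _ [[H1 H2]|[H1 H2]] [[H1' H2']|[H1' H2']]; try tauto.
    + exact (app_func f Y s x x' Hf H2 H2').
    + exact (app_func g Y s x x' Hg H2 H2').
  - exists h; split; [split; [exact Hh|]|exact K].
    intros s x Hx; apply K in Hx; destruct Hx as (_ & [[_ Hx]|[_ Hx]]); eauto.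
Qed.

Lemma pointwise_min Y a phi : nonempty a -> is_fun phi a ->
  (forall i f, app phi i f -> ord_fun Y f) ->
  exists m, ord_fun Y m /\
    (forall i f s x y, app phi i f -> app f s x -> app m s y -> ord_le y x) /\
    (forall s y, app m s y -> exists i f, app phi i f /\ app f s y).
Proof.
  intros [i0 Hi0] Hphi Hord.
  pose (val := fun s x => exists i f, app phi i f /\ app f s x).
  destruct (fun_of_graph (fun s y => least_ord (val s) y) Y) as (m & Hm & K).
  - unfold val; definable.
  - intros s Hs.
    destruct (app_ex phi a i0 Hphi Hi0) as [f Hf].
    destruct (app_ex f Y s (proj1 (Hord _ _ Hf)) Hs) as [x Hx].
    destruct (least_ord_ex (val s) x) as (y & Hy & _); eauto.
    + unfold val; definable.
    + apply (proj2 (Hord _ _ Hf) s x Hx).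
    + exists i0, f; auto.
  - intros s y y' _; apply least_ord_unique.
  - exists m; split; [split; [exact Hm|]|split].
    + intros s y Hy; apply K in Hy; apply Hy.
    + intros i f s x y Hf Hx Hy; apply K in Hy; destruct Hy as (_ & Oy & _ & L).
      destruct (ord_le_or_mem y x Oy (proj2 (Hord _ _ Hf) s x Hx)) as [H|H]; [exact H|].
      destruct (L x H); exists i, f; auto.
    + intros s y Hy; apply K in Hy; apply Hy.
Qed.

Lemma bounded_functions Y alpha : ord_fun Y alpha ->
  exists W, forall f, f ∈ W <-> ord_fun Y f /\ forall s, s ∈ Y -> le_at f alpha s.
Proof.
  intros [Ha Oa].
  destruct (image (fun s y => app alpha s y) Y) as [S HS].
  { definable. }
  { intros s y y' _; exact (app_func alpha Y s y y' Ha). }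
  destruct (zf_union _ hZF S) as [T HT], (binary_union S T) as [U HU].
  destruct (fun_space Y U) as [W0 HW0].
  destruct (sep (fun f => ord_fun Y f /\ forall s, s ∈ Y -> le_at f alpha s) W0) as [W HW];
    [definable|].
  exists W; intro f; rewrite (HW f); split; [tauto|intro H; split; [|exact H]].
  destruct H as [[Hf _] H]; apply HW0; split; [exact Hf|].
  intros s x Hx; assert (Hs := app_dom f Y s x Hf Hx).
  destruct (H s Hs) as (x' & y & Hx' & Hy & K).
  rewrite (app_func f Y s x' x Hf Hx' Hx) in K.
  assert (HyS : y ∈ S) by (apply HS; eauto).
  apply HU; destruct K as [K| ->]; [right; apply HT; eauto|left; exact HyS].
Qed.

(** * Ranks *)

Section Rank.

(** [R] is a definable class relation that plays the role of the rank; [rank_unique]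
    makes it functional, and every function below [alpha] gets a rank by
    [rank_mono]. *)
Context (kappa Y D alpha : M) (R : M -> M -> Prop).
Context (Okappa : is_ord kappa).
Context (HAC : AC_lt kappa).
Context (HD : complete_filter kappa Y D).
Context (Halpha : ord_fun Y alpha).
Context (HR : definable2 R).
Context (Hrec : rank_recursion Y D R).

Let FD : is_filter Y D := proj1 HD.

Lemma rank_unique f a b :
  ord_fun Y f -> is_ord a -> is_ord b -> R f a -> R f b -> a = b.
Proof.
  intros Hf Ha Hb Ra Rb.
  destruct (ord_trichotomy a b Ha Hb) as [K|[K|K]]; [|exact K|]; exfalso.
  - apply (proj1 (Hrec f b Hf Hb) Rb) in K; auto.
  - apply (proj1 (Hrec f a Hf Ha) Ra) in K; auto.
Qed.

Lemma rank_below f g a : ord_fun Y f -> ord_fun Y g -> is_ord a -> R f a ->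
  large D (lt_at g f) -> exists b, b ∈ a /\ R g b.
Proof.
  intros Hf Hg Ha Ra L; apply (proj1 (Hrec f a Hf Ha) Ra); [exact Hg|].
  apply lt_mod_large; auto; apply Hg.
Qed.

Lemma rank_mono f g a : ord_fun Y f -> ord_fun Y g -> is_ord a -> R f a ->
  le_mod D g f -> exists b, is_ord b /\ ord_le b a /\ R g b.
Proof.
  intros Hf Hg Ha Ra L.
  destruct (classic (exists b, b ∈ a /\ R g b)) as [(b & Hb & Rb)|N].
  - exists b; split; [eapply ord_elem; eassumption|split; [left|]; assumption].
  - exists a; split; [exact Ha|split; [right; reflexivity|]].
    apply (Hrec g a Hg Ha); split; [eauto|].
    intros h Hh Lh; apply lt_mod_large in Lh; auto; [|apply Hh].
    apply (rank_below f h a); auto.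
    eapply large_impl; [|exact (large_and Y D _ _ FD Lh L)].
    intros s (_ & (x & y & Hx & Hy & K) & (y' & z & Hy' & Hz & K')).
    rewrite (app_func g Y s y' y (proj1 Hg) Hy' Hy) in K'.
    exists x, z; split; [exact Hx|split; [exact Hz|]].
    eapply ord_mem_le; [|exact K|exact K']; apply (proj2 Hf s z Hz).
Qed.

Context (W : M).
Context (HW : forall f, f ∈ W <-> ord_fun Y f /\ forall s, s ∈ Y -> le_at f alpha s).

Lemma bounded_ord f : f ∈ W -> ord_fun Y f.
Proof. intro H; apply HW, H. Qed.

Lemma bounded_le f s x y : f ∈ W -> app f s x -> app alpha s y -> ord_le x y.
Proof.
  intros H Hx Hy; apply HW in H; destruct H as [Hf H].
  destruct (H s) as (x' & y' & Hx' & Hy' & K); [exact (app_dom f Y s x (proj1 Hf) Hx)|].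
  rewrite (app_func f Y s x x' (proj1 Hf) Hx Hx').
  rewrite (app_func alpha Y s y y' (proj1 Halpha) Hy Hy'); exact K.
Qed.

Lemma alpha_bounded : alpha ∈ W.
Proof.
  apply HW; split; [exact Halpha|]; intros s Hs.
  destruct (app_ex alpha Y s (proj1 Halpha) Hs) as [x Hx].
  exists x, x; split; [exact Hx|split; [exact Hx|right; reflexivity]].
Qed.

Lemma bounded_mod f : f ∈ W -> le_mod D f alpha.
Proof. intro H; apply (large_everywhere Y); auto; apply HW, H. Qed.

(** The recursion for the rank provides some function below [f] whose rank is not
    in [b]; replacing it by [f] where it is not below [f] puts it into the set
    [W] without lowering its rank. *)
Lemma rank_step f b : f ∈ W -> is_ord b -> (forall x, ord_le x b -> ~ R f x) ->
  exists g, g ∈ W /\ large D (lt_at g f) /\ forall x, x ∈ b -> ~ R g x.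
Proof.
  intros HfW Hb N; assert (Hf := bounded_ord f HfW).
  assert (K : exists g, ord_fun Y g /\ lt_mod Y D g f /\ forall x, x ∈ b -> ~ R g x).
  { apply NNPP; intro K; apply (N b); [right; reflexivity|].
    apply (Hrec f b Hf Hb); split; [intros x Hx; apply N; left; exact Hx|].
    intros g Hg L; apply NNPP; intro K'; apply K; exists g; split; [exact Hg|split; [exact L|]].
    intros x Hx Rx; apply K'; eauto. }
  destruct K as (g & Hg & L & Ng); apply lt_mod_large in L; [|exact FD|apply Hg].
  destruct (select Y g f (lt_at g f)) as (h & Hh & Hhv); auto; [definable|].
  assert (E : forall s x, lt_at g f s -> s ∈ Y -> app h s x -> app g s x).
  { intros s x K Hs Hx; apply Hhv in Hx; tauto. }
  exists h; split; [|split].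
  - apply HW; split; [exact Hh|]; intros s Hs.
    destruct (app_ex h Y s (proj1 Hh) Hs) as [x Hx].
    destruct (app_ex alpha Y s (proj1 Halpha) Hs) as [z Hz].
    exists x, z; split; [exact Hx|split; [exact Hz|]].
    apply Hhv in Hx; destruct Hx as (_ & [[(x' & y & Hx' & Hy & K) Hx]|[_ Hx]]).
    + rewrite (app_func g Y s x' x (proj1 Hg) Hx' Hx) in K; left.
      eapply ord_mem_le; [exact (proj2 Halpha s z Hz)|exact K|].
      exact (bounded_le f s y z HfW Hy Hz).
    + exact (bounded_le f s x z HfW Hx Hz).
  - eapply large_impl; [|exact (large_and Y D _ _ FD L L)].
    intros s (Hs & (x & y & Hx & Hy & K) & K').
    exists x, y; split; [|auto]; apply Hhv; auto.
  - intros x Hx Rx.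
    destruct (rank_mono h g x) as (x' & Ox' & Hle & Rx'); auto.
    + eapply ord_elem; eassumption.
    + eapply large_impl; [|exact (large_and Y D _ _ FD L L)].
      intros s (Hs & (u & v & Hu & Hv & K) & K').
      exists u, u; split; [exact Hu|split; [apply Hhv; auto|right; reflexivity]].
    + exact (Ng x' (ord_le_mem x' x b Hb Hle Hx) Rx').
Qed.

(** Induction on the rank [b] of [f].  If all functions of the family had larger
    rank, one could choose below each of them a function in [W] of rank at least
    [b].  The pointwise minimum of the chosen functions lies below [f] mod [D],
    so its rank is less than [b], and it is covered by the chosen functions.  By
    the induction hypothesis one of these has rank less than [b]. *)
Lemma rank_cover a : a ∈ kappa -> forall b, is_ord b ->
  forall f phi, ord_fun Y f -> is_fun phi a -> (forall i g, app phi i g -> g ∈ W) -> R f b ->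
  large D (fun s => exists i g, app phi i g /\ le_at g f s) ->
  exists i g x, app phi i g /\ ord_le x b /\ R g x.
Proof.
  intro Ha; ord_induct.
  intros b Hb IH f phi Hf Hphi HphiW Rb Hcov; apply NNPP; intro N.
  destruct (choose_family a W (fun i g' => exists g, app phi i g /\
    large D (lt_at g' g) /\ forall x, x ∈ b -> ~ R g' x)) as (psi & Hpsi & Hpsiv).
  { apply HAC, Ha. }
  { definable. }
  { intros i Hi; destruct (app_ex phi a i Hphi Hi) as [g Hg].
    destruct (rank_step g b) as (g' & Hg' & L & K); [eauto|exact Hb| |eauto 10].
    intros x Hx Rx; apply N; exists i, g, x; auto. }
  destruct (large_inhabited Y D _ FD Hcov) as (s0 & _ & i0 & g0 & Hg0 & _).
  destruct (pointwise_min Y a psi) as (m & Hm & Hmin & Hatt); auto.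
  { exists i0; exact (app_dom phi a i0 g0 Hphi Hg0). }
  { intros i g Hg; apply bounded_ord, (Hpsiv i g Hg). }
  assert (L : large D (lt_at m f)).
  { assert (I := large_inter kappa Y D a
      (fun i s => forall g g', app phi i g -> app psi i g' -> lt_at g' g s) Okappa HD Ha).
    eapply large_impl; [|refine (large_and Y D _ _ FD Hcov (I _ _))].
    - intros s (Hs & (i & g & Hg & x & y & Hx & Hy & Hle) & _ & K).
      assert (Hi := app_dom phi a i g Hphi Hg).
      destruct (app_ex psi a i Hpsi Hi) as [g' Hg'].
      destruct (K i Hi g g' Hg Hg') as (u & v & Hu & Hv & Huv).
      rewrite (app_func g Y s v x (proj1 (bounded_ord g (HphiW i g Hg))) Hv Hx) in Huv.
      destruct (app_ex m Y s (proj1 Hm) Hs) as [w Hw].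
      exists w, y; split; [exact Hw|split; [exact Hy|]].
      assert (Oy := proj2 Hf s y Hy).
      apply (ord_le_mem w u y Oy (Hmin i g' s u w Hg' Hu Hw)).
      exact (ord_mem_le u x y Oy Huv Hle).
    - definable.
    - intros i Hi; destruct (app_ex phi a i Hphi Hi) as [g Hg].
      destruct (app_ex psi a i Hpsi Hi) as [g' Hg'].
      destruct (Hpsiv i g' Hg') as (_ & g1 & Hg1 & L & _).
      rewrite (app_func phi a i g1 g Hphi Hg1 Hg) in L.
      eapply large_impl; [|exact L]; intros s K h h' Hh Hh'.
      rewrite (app_func phi a i h g Hphi Hh Hg), (app_func psi a i h' g' Hpsi Hh' Hg').
      exact K. }
  destruct (rank_below f m b) as (x & Hx & Rx); auto.
  destruct (IH x Hx m psi) as (i & g & y & Hg & Hle & Ry); auto.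
  - intros i g Hg; apply (Hpsiv i g Hg).
  - apply (large_everywhere Y); auto; intros s Hs.
    destruct (app_ex m Y s (proj1 Hm) Hs) as [w Hw].
    destruct (Hatt s w Hw) as (i & g & Hg & Hgw).
    exists i, g; split; [exact Hg|]; exists w, w; unfold ord_le; auto.
  - destruct (Hpsiv i g Hg) as (_ & _ & _ & _ & K).
    exact (K y (ord_le_mem y x b Hb Hle Hx) Ry).
Qed.

Context (delta : M).
Context (Odelta : is_ord delta).
Context (Rdelta : R alpha delta).

(** * The filter of agreement *)

Lemma agreement_ex : exists E, forall Z, Z ∈ E <-> subset Z Y /\
  exists f, f ∈ W /\ R f delta /\ large D (fun s => s ∈ Z \/ lt_at f alpha s).
Proof.
  destruct (zf_power _ hZF Y) as [P HP].
  destruct (sep (fun Z => exists f, f ∈ W /\ R f delta /\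
    large D (fun s => s ∈ Z \/ lt_at f alpha s)) P) as [E HE]; [definable|].
  exists E; intro Z; rewrite (HE Z), (HP Z); tauto.
Qed.

Context (E : M).
Context (HE : forall Z, Z ∈ E <-> subset Z Y /\
  exists f, f ∈ W /\ R f delta /\ large D (fun s => s ∈ Z \/ lt_at f alpha s)).

(** For each index, choose a witness of full rank.  By [rank_cover] the pointwise
    minimum of the witnesses has full rank, and where it equals [alpha], all
    the witnesses do. *)
Lemma agreement_inter a (G : M -> M -> Prop) B : a ∈ kappa -> definable2 G ->
  (forall i, i ∈ a -> exists Z, Z ∈ E /\ G i Z) -> subset B Y ->
  (forall s, s ∈ Y -> (forall i, i ∈ a -> exists Z, G i Z /\ s ∈ Z) -> s ∈ B) -> B ∈ E.
Proof.
  intros Ha HG H HB HBs; apply HE; split; [exact HB|].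
  destruct (classic (nonempty a)) as [Na|Na].
  2:{ exists alpha; split; [exact alpha_bounded|split; [exact Rdelta|]].
      apply (large_everywhere Y); auto; intros s Hs; left; apply HBs; auto.
      intros i Hi; destruct Na; exists i; exact Hi. }
  destruct (choose_family a W (fun i f => R f delta /\ exists Z, G i Z /\
    large D (fun s => s ∈ Z \/ lt_at f alpha s))) as (phi & Hphi & Hphiv).
  { apply HAC, Ha. }
  { definable. }
  { intros i Hi; destruct (H i Hi) as (Z & HZ & HGZ).
    apply HE in HZ; destruct HZ as (_ & f & Hf & Rf & L); eauto 8. }
  destruct (pointwise_min Y a phi) as (m & Hm & Hmin & Hatt); auto.
  { intros i g Hg; apply bounded_ord, (Hphiv i g Hg). }
  assert (HmW : m ∈ W).
  { apply HW; split; [exact Hm|]; intros s Hs.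
    destruct (app_ex m Y s (proj1 Hm) Hs) as [w Hw].
    destruct (Hatt s w Hw) as (i & g & Hg & Hgw).
    destruct (app_ex alpha Y s (proj1 Halpha) Hs) as [z Hz].
    exists w, z; split; [exact Hw|split; [exact Hz|]].
    apply (bounded_le g s w z); auto; apply (Hphiv i g Hg). }
  exists m; split; [exact HmW|split].
  - destruct (rank_mono alpha m delta) as (b & Ob & Hle & Rb); auto using bounded_mod.
    destruct (rank_cover a Ha b Ob m phi) as (i & g & x & Hg & Hx & Rx); auto.
    + intros i g Hg; apply (Hphiv i g Hg).
    + apply (large_everywhere Y); auto; intros s Hs.
      destruct (app_ex m Y s (proj1 Hm) Hs) as [w Hw].
      destruct (Hatt s w Hw) as (i & g & Hg & Hgw).
      exists i, g; split; [exact Hg|]; exists w, w; unfold ord_le; auto.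
    + destruct (Hphiv i g Hg) as (HgW & Rg & _).
      assert (Ox : is_ord x).
      { destruct Hx as [Hx| ->]; [exact (ord_elem b x Ob Hx)|exact Ob]. }
      rewrite (rank_unique g x delta) in Hx; auto using bounded_ord.
      destruct Hle as [Hle| ->]; [|exact Rb].
      destruct (ord_le_not_mem _ _ Hx Hle).
  - assert (I := large_inter kappa Y D a
      (fun i s => (exists Z, G i Z /\ s ∈ Z) \/ exists f, app phi i f /\ lt_at f alpha s)
      Okappa HD Ha).
    eapply large_impl; [|apply I].
    + intros s [Hs K].
      destruct (classic (exists i f, i ∈ a /\ app phi i f /\ lt_at f alpha s))
        as [(i & f & Hi & Hf & x & y & Hx & Hy & Hxy)|N].
      * right; destruct (app_ex m Y s (proj1 Hm) Hs) as [w Hw].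
        exists w, y; split; [exact Hw|split; [exact Hy|]].
        apply (ord_le_mem w x y); auto; [exact (proj2 Halpha s y Hy)|].
        exact (Hmin i f s x w Hf Hx Hw).
      * left; apply HBs; [exact Hs|]; intros i Hi.
        destruct (K i Hi) as [K'|(f & Hf & K')]; [exact K'|].
        destruct N; eauto.
    + definable.
    + intros i Hi; destruct (app_ex phi a i Hphi Hi) as [f Hf].
      destruct (Hphiv i f Hf) as (_ & _ & Z & HZ & L).
      eapply large_impl; [|exact L]; intros s [K|K]; [left|right]; eauto.
Qed.

Lemma agreement_extends : subset D E.
Proof.
  intros Z HZ; apply HE; split; [apply FD, HZ|].
  exists alpha; split; [exact alpha_bounded|split; [exact Rdelta|]].
  exists Z; auto.
Qed.

Context (omega : M).
Context (Homega : is_omega omega).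
Context (Homega_kappa : omega ∈ kappa).

Lemma agreement_complete : complete_filter kappa Y E.
Proof.
  split; [split; [|split; [|split; [|split]]]|].
  - intros A HA; apply HE, HA.
  - apply agreement_extends, FD.
  - intros A HA; apply HE in HA; destruct HA as (_ & f & Hf & Rf & L).
    apply NNPP; intro N.
    destruct (rank_below alpha f delta) as (b & Hb & Rb); auto using bounded_ord.
    + eapply large_impl; [|exact L]; intros s [Hs|Hs]; [|exact Hs].
      destruct N; exists s; exact Hs.
    + rewrite (rank_unique f b delta) in Hb; auto using bounded_ord.
      * exact (mem_irrefl _ Hb).
      * eapply ord_elem; eassumption.
  - intros A B HA HAB HB; apply HE in HA; destruct HA as (_ & f & Hf & Rf & L).
    apply HE; split; [exact HB|]; exists f; split; [exact Hf|split; [exact Rf|]].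
    eapply large_impl; [|exact L]; intros s [Hs|Hs]; [left; apply HAB|right]; exact Hs.
  - (* the family indexed by [omega] with value [A] at [z] and [B] elsewhere *)
    intros A B C HA HB HC.
    destruct Homega as (_ & (_ & (y & Hy) & Hlim) & _).
    destruct (Hlim y Hy) as (z & Hz & Hyz).
    apply (agreement_inter omega (fun i Z => i = z /\ Z = A \/ i <> z /\ Z = B)); auto.
    + definable.
    + intros i Hi; destruct (classic (i = z)); eauto.
    + intros s Hs; apply HC in Hs; apply HE in HA; apply HA, Hs.
    + intros s Hs K; apply HC; split.
      * destruct (K z Hz) as (Z & [[_ ->]|[N _]] & HsZ); [exact HsZ|destruct N; reflexivity].
      * destruct (K y Hy) as (Z & [[E1 _]|[_ ->]] & HsZ); [|exact HsZ].
        subst z; destruct (mem_irrefl y Hyz).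
  - intros A B HA (a & h & Ha & [[[Hh HhA] Hon] _]) HB.
    apply (agreement_inter a (fun i Z => app h i Z)); auto.
    + definable.
    + intros i Hi; destruct (app_ex h a i Hh Hi) as [Z HZ].
      exists Z; split; [apply HA, (HhA i Z HZ)|exact HZ].
    + intros s Hs; exact (proj1 (proj1 (HB s) Hs)).
    + intros s Hs K; apply HB; split; [exact Hs|]; intros C HC.
      destruct (Hon C HC) as [i Hi].
      destruct (K i (app_dom h a i C Hh Hi)) as (Z & HZ & HsZ).
      rewrite (app_func h a i C Z Hh Hi HZ); exact HsZ.
Qed.

(** * The cofinality of the rank *)

Context (c : M).
Context (Hc : is_cof delta c).

Lemma cof_ord : is_ord c.
Proof. apply Hc. Qed.

(** By minimality of [c] the map with graph [G] is not cofinal, and an element of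
    [delta] that no value reaches is a strict upper bound of the values. *)
Lemma not_cofinal i (G : M -> M -> Prop) : is_ord i -> ~ ord_le c i -> definable2 G ->
  (forall j, j ∈ i -> exists y, G j y) ->
  (forall j y y', j ∈ i -> G j y -> G j y' -> y = y') ->
  (forall j y, j ∈ i -> G j y -> y ∈ delta) ->
  exists x, x ∈ delta /\ forall j y, j ∈ i -> G j y -> y ∈ x.
Proof.
  intros Oi Hi HG Ge Gu Gd.
  destruct (fun_of_graph G i HG Ge Gu) as (h & Hh & Hhv).
  destruct Hc as (Oc & _ & L).
  assert (Hic : i ∈ c) by (destruct (ord_le_or_mem c i Oc Oi); tauto).
  apply NNPP; intro N; apply (L i Hic); exists h; split.
  - split; [exact Hh|]; intros j y Hy; apply Hhv in Hy; eapply Gd; apply Hy.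
  - intros x Hx; apply NNPP; intro K; apply N; exists x; split; [exact Hx|].
    intros j y Hj Hy.
    destruct (ord_le_or_mem x y) as [H|H]; [| |destruct K|exact H].
    + exact (ord_elem delta x Odelta Hx).
    + apply (ord_elem delta y Odelta); eapply Gd; eassumption.
    + exists j, y; split; [apply Hhv; auto|exact H].
Qed.

Lemma cof_not_le i : i ∈ c -> is_ord i /\ ~ ord_le c i.
Proof.
  intro Hi; split; [exact (ord_elem c i cof_ord Hi)|].
  intro K; exact (ord_le_not_mem c i K Hi).
Qed.

Context (Fil theta : M).
Context (HFil : is_Fil1 kappa Y Fil).
Context (Htheta : is_theta Fil theta).
Context (Hle : ord_le theta c).

(** Otherwise the values are unbounded in [delta], and an ordinal [xi] enumerates
    them.  Since [xi] is at least the cofinality of [delta], which is at least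
    [theta], sending a filter to the index of its value, when this is in
    [theta], maps [Fil] onto [theta]. *)
Lemma pigeonhole (T : M -> M -> Prop) : definable2 T ->
  (forall d x x', d ∈ Fil -> T d x -> T d x' -> x = x') ->
  (forall d x, d ∈ Fil -> T d x -> x ∈ delta) ->
  exists b, b ∈ delta /\ forall d x, d ∈ Fil -> T d x -> x ∈ b.
Proof.
  intros HT Tu Td; apply NNPP; intro N.
  destruct (sep (fun x => exists d, d ∈ Fil /\ T d x) delta) as [X HX]; [definable|].
  destruct (enumeration X delta Odelta) as (xi & h & Oxi & _ & [[Hh HhX] Hon] & Hinj).
  { intros x Hx; apply HX, Hx. }
  assert (Hcxi : ord_le c xi).
  { apply NNPP; intro K.
    destruct (not_cofinal xi (fun i x => app h i x)) as (b & Hb & Hbx); auto.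
    - definable.
    - intros j Hj; exact (app_ex h xi j Hh Hj).
    - intros j y y' _; exact (app_func h xi j y y' Hh).
    - intros j y _ Hy; apply HX, (HhX j y Hy).
    - apply N; exists b; split; [exact Hb|]; intros d x Hd Hx.
      destruct (Hon x) as [i Hi]; [apply HX; split; [exact (Td d x Hd Hx)|eauto]|].
      apply (Hbx i x); [exact (app_dom h xi i x Hh Hi)|exact Hi]. }
  assert (Hthxi : ord_le theta xi) by exact (ord_le_trans theta c xi Oxi Hle Hcxi).
  destruct Htheta as (Oth & ((t0 & Ht0) & Hno) & _); apply Hno.
  pose (V := fun d t => t ∈ theta /\ exists x, T d x /\ app h t x).
  destruct (fun_of_graph (fun d t => V d t \/ (~ exists t, V d t) /\ t = t0) Fil)
    as (g & Hg & Hgv).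
  - unfold V; definable.
  - intros d Hd; destruct (classic (exists t, V d t)) as [[t Ht]|K]; eauto.
  - intros d t t' Hd [(Ht & x & Hx & Hhx)|[K ->]] [(Ht' & x' & Hx' & Hhx')|[K' ->]].
    + rewrite (Tu d x' x Hd Hx' Hx) in Hhx'; exact (Hinj _ _ _ Hhx Hhx').
    + destruct K'; exists t; unfold V; eauto.
    + destruct K; exists t'; unfold V; eauto.
    + reflexivity.
  - exists g; split; [split; [exact Hg|]|].
    + intros d t Ht; apply Hgv in Ht; destruct Ht as (_ & [[Ht _]|[_ ->]]); auto.
    + intros t Ht.
      assert (Htxi : t ∈ xi) by exact (ord_mem_le t theta xi Oxi Ht Hthxi).
      destruct (app_ex h xi t Hh Htxi) as [x Hx].
      destruct (proj1 (HX x) (HhX t x Hx)) as (_ & d & Hd & Tx).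
      exists d; apply Hgv; split; [exact Hd|left; split; eauto].
Qed.

Lemma D_in_Fil : D ∈ Fil.
Proof. apply HFil, HD. Qed.

(** The constant assignment of a maximal element to the filters, of which there
    is at least one, would contradict [pigeonhole]. *)
Lemma delta_no_max m : m ∈ delta -> exists x, x ∈ delta /\ m ∈ x.
Proof.
  intro Hm; destruct (pigeonhole (fun d x => x = m)) as (b & Hb & K).
  - definable.
  - intros; congruence.
  - intros d x _ ->; exact Hm.
  - exists b; split; [exact Hb|]; exact (K D m D_in_Fil eq_refl).
Qed.

Lemma delta_nonempty : nonempty delta.
Proof.
  destruct (pigeonhole (fun d x => False)) as (b & Hb & _); try tauto; [definable|].
  exists b; exact Hb.
Qed.

Lemma delta_max x y : x ∈ delta -> y ∈ delta ->
  exists z, z ∈ delta /\ ord_le x z /\ ord_le y z.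
Proof.
  intros Hx Hy.
  destruct (ord_le_or_mem x y (ord_elem delta x Odelta Hx)
    (ord_elem delta y Odelta Hy)) as [K|K].
  - exists y; split; [exact Hy|split; [exact K|right; reflexivity]].
  - exists x; split; [exact Hx|split; [right; reflexivity|left; exact K]].
Qed.

(** If [i] were the last element of [c], then the values of a cofinal map before
    [i] would be bounded, and the larger of this bound and the value at [i] would
    be maximal in [delta]. *)
Lemma cof_limit : is_limit c.
Proof.
  destruct Hc as (Oc & (h & [Hh Hhd] & Hcof) & _).
  split; [exact Oc|split].
  - destruct delta_nonempty as [x Hx]; destruct (Hcof x Hx) as (i & y & Hi & _).
    exists i; exact (app_dom h c i y Hh Hi).
  - intros i Hi; apply NNPP; intro N.
    destruct (cof_not_le i Hi) as [Oi Ni].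
    assert (S : forall j, j ∈ i -> j ∈ c) by (intros j Hj; exact (ord_trans j i c Oc Hj Hi)).
    destruct (not_cofinal i (fun j y => app h j y)) as (x & Hx & Hxb); auto.
    + definable.
    + intros j Hj; exact (app_ex h c j Hh (S j Hj)).
    + intros j y y' _; exact (app_func h c j y y' Hh).
    + intros j y _; apply Hhd.
    + destruct (app_ex h c i Hh Hi) as [u Hu].
      destruct (delta_max x u Hx (Hhd i u Hu)) as (m & Hm & Hxm & Hum).
      destruct (delta_no_max m Hm) as (w & Hw & Hmw).
      destruct (Hcof w Hw) as (k & v & Hk & Hwv).
      assert (Ov : is_ord v) by exact (ord_elem delta v Odelta (Hhd k v Hk)).
      assert (Hmv : m ∈ v) by exact (ord_mem_le m w v Ov Hmw Hwv).
      assert (Hkc := app_dom h c k v Hh Hk).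
      destruct (proj2 Oc k i Hkc Hi) as [K|[K|K]].
      * apply (ord_le_not_mem _ _ Hxm).
        exact (ord_trans m v x (ord_elem delta x Odelta Hx) Hmv (Hxb k v K Hk)).
      * subst k; rewrite (app_func h c i v u Hh Hk Hu) in Hmv.
        exact (ord_le_not_mem _ _ Hum Hmv).
      * apply N; eauto.
Qed.

(** * Bounding the ranks of selections *)

Definition eq_at f g s : Prop := exists x, app f s x /\ app g s x.
(** [d] is the filter generated by [D] and the set of points where [f] differs
    from [alpha]. *)
Definition code f d : Prop :=
  forall Z, Z ∈ d <-> subset Z Y /\ large D (fun s => s ∈ Z \/ eq_at f alpha s).
Definition selection f f' : Prop :=
  f' ∈ W /\ forall s x, app f' s x -> app f s x \/ app alpha s x.
Hint Unfold eq_at code selection : dfndb.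

Lemma code_ex f : exists d, code f d.
Proof.
  destruct (zf_power _ hZF Y) as [P HP].
  destruct (sep (fun Z => large D (fun s => s ∈ Z \/ eq_at f alpha s)) P) as [d Hd];
    [definable|].
  exists d; intro Z; rewrite (Hd Z), (HP Z); tauto.
Qed.

(** A function equal to [alpha] almost everywhere has rank [delta]. *)
Lemma not_large_eq f r : f ∈ W -> R f r -> r ∈ delta -> ~ large D (eq_at f alpha).
Proof.
  intros Hf Hr Hrd L.
  assert (Or := ord_elem delta r Odelta Hrd).
  destruct (rank_mono f alpha r) as (b & Ob & Hbr & Rb); auto using bounded_ord.
  - eapply large_impl; [|exact L]; intros s (x & Hx & Hy).
    exists x, x; unfold ord_le; auto.
  - rewrite (rank_unique alpha b delta) in Hbr; auto.
    exact (ord_le_not_mem _ _ Hbr Hrd).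
Qed.

(** Only properness depends on the rank: it holds because [f] differs from [alpha]
    on a set that is positive for [D]. *)
Lemma code_complete f d r : f ∈ W -> R f r -> r ∈ delta -> code f d -> complete_filter kappa Y d.
Proof.
  intros Hf Rf Hr Hd.
  assert (N := not_large_eq f r Hf Rf Hr).
  split; [split; [|split; [|split; [|split]]]|].
  - intros A HA; apply Hd, HA.
  - apply Hd; split; [intros s Hs; exact Hs|].
    apply (large_everywhere Y); auto.
  - intros A HA; apply Hd in HA; destruct HA as [_ L].
    apply NNPP; intro K; apply N; eapply large_impl; [|exact L].
    intros s [Hs|Hs]; [destruct K; exists s; exact Hs|exact Hs].
  - intros A B HA HAB HB; apply Hd in HA; apply Hd; split; [exact HB|].
    eapply large_impl; [|apply HA]; intros s [Hs|Hs]; auto.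
  - intros A B C HA HB HC; apply Hd in HA, HB; apply Hd; split.
    + intros s Hs; apply HA, HC, Hs.
    + eapply large_impl; [|exact (large_and Y D _ _ FD (proj2 HA) (proj2 HB))].
      intros s (_ & [K|K] & [K'|K']); auto; left; apply HC; auto.
  - intros A B HA (a & h & Ha & [[[Hh HhA] Hon] _]) HB; apply Hd; split.
    + intros s Hs; exact (proj1 (proj1 (HB s) Hs)).
    + eapply large_impl; [|apply (large_inter kappa Y D a
        (fun i s => (exists Z, app h i Z /\ s ∈ Z) \/ eq_at f alpha s) Okappa HD Ha)].
      * intros s [Hs K]; destruct (classic (eq_at f alpha s)) as [Q|Q]; [right; exact Q|left].
        apply HB; split; [exact Hs|]; intros C HC; destruct (Hon C HC) as [i Hi].
        destruct (K i (app_dom h a i C Hh Hi)) as [(Z & HZ & HsZ)|K']; [|contradiction].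
        rewrite (app_func h a i C Z Hh Hi HZ); exact HsZ.
      * definable.
      * intros i Hi; destruct (app_ex h a i Hh Hi) as [Z HZ].
        assert (HZd := HA Z (HhA i Z HZ)); apply Hd in HZd.
        eapply large_impl; [|apply HZd]; intros s [K|K]; eauto.
Qed.

(** The set where [f1] differs from [alpha] belongs to [d].  As [f2] generates
    [d] too, almost every point lies in this set or has [f2] equal to [alpha]. *)
Lemma code_determines f1 f2 d : code f1 d -> code f2 d ->
  large D (fun s => s ∈ Y /\ (eq_at f1 alpha s -> eq_at f2 alpha s)).
Proof.
  intros C1 C2.
  destruct (sep (fun s => ~ eq_at f1 alpha s) Y) as [Z HZ]; [definable|].
  assert (HZd : Z ∈ d).
  { apply C1; split; [intros s Hs; apply HZ, Hs|].
    apply (large_everywhere Y); auto; intros s Hs.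
    destruct (classic (eq_at f1 alpha s)); [right|left]; [|apply HZ]; auto. }
  apply C2 in HZd.
  eapply large_impl; [|exact (large_and Y D _ _ FD (proj2 HZd) (proj2 HZd))].
  intros s (Hs & [K|K] & _); split; auto.
  intro Q; apply HZ in K; tauto.
Qed.

(** Almost everywhere both selections take the value of [alpha], or both take the
    value of [f]. *)
Lemma same_code_le f f1 f2 d : ord_fun Y f -> selection f f1 -> selection f f2 ->
  code f1 d -> code f2 d -> le_mod D f1 f2.
Proof.
  intros Hf S1 S2 C1 C2.
  eapply large_impl; [|exact (code_determines f1 f2 d C1 C2)].
  intros s [Hs K].
  destruct S1 as [H1 S1], S2 as [H2 S2].
  destruct (app_ex f1 Y s (proj1 (bounded_ord _ H1)) Hs) as [x Hx].
  destruct (app_ex f2 Y s (proj1 (bounded_ord _ H2)) Hs) as [y Hy].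
  exists x, y; split; [exact Hx|split; [exact Hy|]].
  destruct (S2 s y Hy) as [Hfy|Hay].
  - destruct (S1 s x Hx) as [Hfx|Hax].
    + right; exact (app_func f Y s x y (proj1 Hf) Hfx Hfy).
    + destruct K as (z & Hz & Haz); [exists x; auto|].
      rewrite (app_func f2 Y s y z (proj1 (bounded_ord _ H2)) Hy Hz).
      right; exact (app_func alpha Y s x z (proj1 Halpha) Hax Haz).
  - exact (bounded_le f1 s x y H1 Hx Hay).
Qed.

(** By [same_code_le] the code of a selection determines its rank, so
    [pigeonhole] applies to the ranks below [delta]. *)
Lemma selection_bound f : ord_fun Y f -> exists b, b ∈ delta /\
  forall f' r, selection f f' -> r ∈ delta -> R f' r -> r ∈ b.
Proof.
  intro Hf.
  destruct (pigeonhole (fun d r => exists f', selection f f' /\ code f' d /\ R f' r /\ r ∈ delta))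
    as (b & Hb & K).
  - definable.
  - assert (K : forall d f1 f2 r1 r2, selection f f1 -> selection f f2 -> code f1 d -> code f2 d ->
      R f1 r1 -> R f2 r2 -> r1 ∈ delta -> r2 ∈ delta -> ord_le r1 r2).
    { intros d f1 f2 r1 r2 S1 S2 C1 C2 R1 R2 D1 D2.
      destruct (rank_mono f2 f1 r2) as (r & Or & Hr & Rr); auto.
      - apply bounded_ord, S2.
      - apply bounded_ord, S1.
      - exact (ord_elem delta r2 Odelta D2).
      - eapply same_code_le; eassumption.
      - rewrite (rank_unique f1 r1 r); auto.
        + apply bounded_ord, S1.
        + exact (ord_elem delta r1 Odelta D1). }
    intros d r1 r2 _ (f1 & S1 & C1 & R1 & D1) (f2 & S2 & C2 & R2 & D2).
    assert (K1 : ord_le r1 r2) by (eapply (K d f1 f2); eassumption).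
    assert (K2 : ord_le r2 r1) by (eapply (K d f2 f1); eassumption).
    destruct K1 as [K1|K1]; [|exact K1]; destruct (ord_le_not_mem _ _ K2 K1).
  - intros d r _ (f' & _ & _ & _ & Hr); exact Hr.
  - exists b; split; [exact Hb|]; intros f' r S Hr Rr.
    destruct (code_ex f') as [d Hd].
    apply (K d); [|exists f'; auto].
    apply HFil, (code_complete f' d r); auto; apply S.
Qed.

(** * The pseudo true cofinality *)

Let FE : is_filter Y E := proj1 agreement_complete.

Definition dominated f b : Prop :=
  forall g r, g ∈ W -> is_ord r -> ord_le b r -> R g r -> large E (lt_at f g).
Hint Unfold dominated : dfndb.

(** Take [b] from [selection_bound].  The selection [f'] that is [f] where
    [g <= f < alpha] and [alpha] elsewhere is at least [g], so it has full rank,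
    hence agrees with [alpha] on a set in [E]. *)
Lemma dominated_ex f : ord_fun Y f -> large E (lt_at f alpha) ->
  exists b, b ∈ delta /\ dominated f b.
Proof.
  intros Hf L; destruct (selection_bound f Hf) as (b & Hb & K).
  exists b; split; [exact Hb|]; intros g r Hg Or Hbr Rg.
  destruct (select Y f alpha (fun s => lt_at f alpha s /\ le_at g f s)) as (f' & Hf' & Hv);
    auto; [definable|].
  assert (Hle' : forall s x y, app f' s x -> app alpha s y -> ord_le x y).
  { intros s x y Hx Hy; apply Hv in Hx.
    destruct Hx as (Hs & [[[(u & v & Hu & Hv' & Huv) _] Hx]|[_ Hx]]).
    - rewrite (app_func f Y s x u (proj1 Hf) Hx Hu).
      rewrite (app_func alpha Y s y v (proj1 Halpha) Hy Hv'); left; exact Huv.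
    - right; exact (app_func alpha Y s x y (proj1 Halpha) Hx Hy). }
  assert (HfW : f' ∈ W).
  { apply HW; split; [exact Hf'|]; intros s Hs.
    destruct (app_ex f' Y s (proj1 Hf') Hs) as [x Hx].
    destruct (app_ex alpha Y s (proj1 Halpha) Hs) as [y Hy]; exists x, y; eauto. }
  assert (Hsel : selection f f').
  { split; [exact HfW|]; intros s x Hx; apply Hv in Hx; tauto. }
  assert (Hgf : le_mod D g f').
  { apply (large_everywhere Y); auto; intros s Hs.
    destruct (app_ex g Y s (proj1 (bounded_ord g Hg)) Hs) as [x Hx].
    destruct (app_ex f' Y s (proj1 Hf') Hs) as [y Hy].
    exists x, y; split; [exact Hx|split; [exact Hy|]].
    apply Hv in Hy; destruct Hy as (_ & [[[_ (u & v & Hu & Hv' & Huv)] Hy]|[_ Hy]]).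
    - rewrite (app_func g Y s x u (proj1 (bounded_ord g Hg)) Hx Hu).
      rewrite (app_func f Y s y v (proj1 Hf) Hy Hv'); exact Huv.
    - exact (bounded_le g s x y Hg Hx Hy). }
  destruct (rank_mono alpha f' delta) as (r' & Or' & Hr' & Rr'); auto using bounded_mod.
  destruct (rank_mono f' g r') as (r2 & Or2 & Hr2 & Rr2); auto using bounded_ord.
  rewrite (rank_unique g r2 r) in Hr2; auto using bounded_ord.
  assert (r' = delta) as ->.
  { destruct Hr' as [Hr'|Hr']; [|exact Hr'].
    destruct (ord_le_not_mem b r' (ord_le_trans b r r' Or' Hbr Hr2)).
    exact (K f' r' Hsel Hr' Rr'). }
  assert (L' : large E (eq_at f' alpha)).
  { destruct (sep (eq_at f' alpha) Y) as [Z HZ]; [definable|].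
    exists Z; split; [|intros s Hs; apply HZ, Hs].
    apply HE; split; [intros s Hs; apply HZ, Hs|].
    exists f'; split; [exact HfW|split; [exact Rr'|]].
    apply (large_everywhere Y); auto; intros s Hs.
    destruct (app_ex f' Y s (proj1 Hf') Hs) as [x Hx].
    destruct (app_ex alpha Y s (proj1 Halpha) Hs) as [y Hy].
    destruct (Hle' s x y Hx Hy) as [Hxy|<-]; [right; exists x, y; auto|].
    left; apply HZ; split; [exact Hs|exists x; auto]. }
  eapply large_impl; [|exact (large_and Y E _ _ FE L L')].
  intros s (Hs & HL & x & Hx & Hax).
  apply Hv in Hx; destruct Hx as (_ & [[_ Hx]|[N _]]).
  - destruct HL as (u & v & Hu & Hv' & Huv).
    rewrite (app_func f Y s u x (proj1 Hf) Hu Hx) in Huv.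
    rewrite (app_func alpha Y s v x (proj1 Halpha) Hv' Hax) in Huv.
    destruct (mem_irrefl x Huv).
  - destruct (app_ex f Y s (proj1 Hf) Hs) as [u Hu].
    destruct (app_ex g Y s (proj1 (bounded_ord g Hg)) Hs) as [v Hv'].
    exists u, v; split; [exact Hu|split; [exact Hv'|]].
    destruct (ord_le_or_mem v u) as [K'|K']; [| |destruct N|exact K'].
    + exact (proj2 (bounded_ord g Hg) s v Hv').
    + exact (proj2 Hf s u Hu).
    + split; [exact HL|exists v, u; auto].
Qed.

Definition ranked_from x f : Prop :=
  f ∈ W /\ large D (lt_at f alpha) /\ exists r, r ∈ delta /\ ord_le x r /\ R f r.
Hint Unfold ranked_from : dfndb.

(** [rank_step] for [alpha], whose rank is above [x]. *)
Lemma ranked_from_ex x : x ∈ delta -> exists f, ranked_from x f.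
Proof.
  intro Hx; assert (Ox := ord_elem delta x Odelta Hx).
  destruct (rank_step alpha x alpha_bounded Ox) as (g & Hg & L & N).
  - intros y Hy Ry.
    assert (Hyd := ord_le_mem y x delta Odelta Hy Hx).
    rewrite (rank_unique alpha y delta) in Hyd; auto.
    + exact (mem_irrefl _ Hyd).
    + exact (ord_elem delta y Odelta Hyd).
  - destruct (rank_below alpha g delta) as (r & Hr & Rr); auto using bounded_ord.
    exists g; split; [exact Hg|split; [exact L|]]; exists r; split; [exact Hr|split; [|exact Rr]].
    destruct (ord_le_or_mem x r Ox (ord_elem delta r Odelta Hr)) as [K|K]; [exact K|].
    destruct (N r K Rr).
Qed.

Lemma large_E P : large D P -> large E P.
Proof. intros (A & HA & K); exists A; split; [apply agreement_extends, HA|exact K]. Qed.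

Lemma ranked_dominated f b x g : dominated f b -> ranked_from x g -> ord_le b x ->
  large E (lt_at f g).
Proof.
  intros Hd (Hg & _ & r & Hr & Hxr & Rr) Hbx.
  assert (Or := ord_elem delta r Odelta Hr).
  apply (Hd g r); auto; eapply ord_le_trans; eassumption.
Qed.

(** Between the ranks [x] and [next x] there is room for one level of the pseudo
    scale: some function of rank at least [x] is below all of rank [next x]. *)
Definition next x b : Prop :=
  least_ord (fun b => b ∈ delta /\ exists f, ranked_from x f /\ dominated f b) b.
Hint Unfold next : dfndb.

Lemma next_ex x : x ∈ delta -> exists b, next x b.
Proof.
  intro Hx; destruct (ranked_from_ex x Hx) as [f Hf].
  destruct (dominated_ex f) as (b & Hb & Hd).
  - apply bounded_ord, Hf.
  - apply large_E, Hf.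
  - destruct (least_ord_ex (fun b => b ∈ delta /\ exists f, ranked_from x f /\ dominated f b) b)
      as (m & Hm & _); eauto.
    + definable.
    + exact (ord_elem delta b Odelta Hb).
Qed.

Lemma next_unique x b b' : next x b -> next x b' -> b = b'.
Proof. apply least_ord_unique. Qed.

(** The sequence [p] dominates the cofinal map [h] and passes [next] of all its
    earlier values.  At stage [i] the values of [h] and [next] so far are bounded
    in [delta] because [i] is below the cofinality. *)
Lemma scale_ex h : fun_to h c delta -> exists p, is_fun p c /\
  forall i y, app p i y -> y ∈ delta /\ forall j, j ∈ i ->
    (exists u, app h j u /\ ord_le u y) /\
    exists x b, app p j x /\ next x b /\ ord_le b y.
Proof.
  intros [Hh Hhd]; assert (Oc := cof_ord).
  pose (good := fun p b => b ∈ delta /\ forall j x, app p j x ->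
    (exists u, app h j u /\ ord_le u b) /\ exists e, next x e /\ ord_le e b).
  assert (dgood : definable2 good) by (unfold good; definable).
  (* the second alternative only makes [H] total *)
  pose (H := fun p y => least_ord (fun b => good p b \/ ~ exists b', good p b') y).
  destruct (ord_recursion H) with (i := c) as (p & Hp & HpH); auto.
  { unfold H; definable. }
  { intro p.
    assert (K : exists b, is_ord b /\ (good p b \/ ~ exists b', good p b')).
    { destruct (classic (exists b', good p b')) as [[b Hb]|N]; [|exists delta; auto].
      exists b; split; [exact (ord_elem delta b Odelta (proj1 Hb))|auto]. }
    destruct K as (b & Ob & Pb).
    destruct (least_ord_ex (fun b => good p b \/ ~ exists b', good p b') b)
      as (m & Hm & _); auto; [definable|exists m; exact Hm]. }
  { intros q y y'; apply least_ord_unique. }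
  exists p; split; [exact Hp|].
  assert (K : forall i, is_ord i -> i ∈ c -> forall y, app p i y -> y ∈ delta /\ forall j, j ∈ i ->
    (exists u, app h j u /\ ord_le u y) /\
    exists x b, app p j x /\ next x b /\ ord_le b y).
  { ord_induct; intros i Oi IH Hi y Hy.
    assert (S : forall j, j ∈ i -> j ∈ c) by (intros j Hj; exact (ord_trans j i c Oc Hj Hi)).
    destruct (cof_not_le i Hi) as [_ Ni].
    destruct (not_cofinal i (fun j u => app h j u)) as (b1 & Hb1 & K1); auto.
    { definable. }
    { intros j Hj; exact (app_ex h c j Hh (S j Hj)). }
    { intros j u u' _; exact (app_func h c j u u' Hh). }
    { intros j u _; apply Hhd. }
    destruct (not_cofinal i (fun j e => exists x, app p j x /\ next x e)) as (b2 & Hb2 & K2); auto.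
    { definable. }
    { intros j Hj; destruct (app_ex p c j Hp (S j Hj)) as [x Hx].
      destruct (next_ex x) as [e He]; [apply (IH j Hj (S j Hj) x Hx)|eauto]. }
    { intros j e e' Hj (x & Hx & He) (x' & Hx' & He').
      rewrite (app_func p c j x' x Hp Hx' Hx) in He'; exact (next_unique x e e' He He'). }
    { intros j e _ (x & _ & He); apply He. }
    destruct (delta_max b1 b2 Hb1 Hb2) as (b & Hb & H1 & H2).
    assert (Ob := ord_elem delta b Odelta Hb).
    destruct (restr_ex p c i Hp S) as [q Hq].
    assert (Gb : good q b).
    { split; [exact Hb|]; intros j x Hx.
      assert (Hj := app_dom q i j x (proj1 Hq) Hx); apply Hq in Hx.
      split.
      - destruct (app_ex h c j Hh (S j Hj)) as [u Hu]; exists u; split; [exact Hu|].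
        left; exact (ord_mem_le u b1 b Ob (K1 j u Hj Hu) H1).
      - destruct (next_ex x) as [e He]; [apply (IH j Hj (S j Hj) x Hx)|].
        exists e; split; [exact He|].
        left; apply (ord_mem_le e b2 b Ob); [apply (K2 j e Hj)|exact H2]; eauto. }
    destruct (HpH i q y Hi Hq Hy) as (_ & [Gy|N] & _); [|destruct N; eauto].
    split; [apply Gy|]; intros j Hj.
    destruct (app_ex p c j Hp (S j Hj)) as [x Hx].
    destruct (proj2 Gy j x) as [Gu (e & He & Hey)].
    - exact (restr_app q p c i j x Hp Hq Hj Hx).
    - split; [exact Gu|eauto]. }
  intros i y Hy; assert (Hi := app_dom p c i y Hp Hy).
  apply (K i); auto; exact (ord_elem c i Oc Hi).
Qed.

(** The level at [i] consists of the functions of rank at least [p i] that are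
    dominated from [next] of [p i] on, and [p j] is at least this ordinal for all
    later [j]. *)
Lemma pstcf_cof : has_pstcf Y E alpha c.
Proof.
  assert (Lc := cof_limit); assert (Oc := cof_ord); split; [exact Lc|].
  assert (Hcf := Hc); destruct Hcf as (_ & (h & Hh & Hcof) & _).
  destruct (scale_ex h Hh) as (p & Hp & Hpv).
  pose (mem_at := fun i f => exists x b, app p i x /\ next x b /\ ranked_from x f /\ dominated f b).
  destruct (fun_of_graph (fun i A => forall f, f ∈ A <-> f ∈ W /\ mem_at i f) c)
    as (F & HF & HFv).
  { unfold mem_at; definable. }
  { intros i _; apply (sep (fun f => mem_at i f)); unfold mem_at; definable. }
  { intros i A A' _ HA HA'; apply ext; intro f; rewrite (HA f), (HA' f); tauto. }
  assert (Hin : forall i A f, app F i A -> f ∈ A -> mem_at i f).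
  { intros i A f HA Hf; apply HFv in HA; apply HA in Hf; apply Hf. }
  exists F; split; [exact HF|split; [|split]].
  - intros i A HA; split.
    + apply HFv in HA; destruct HA as [Hi HA].
      destruct (app_ex p c i Hp Hi) as [x Hx].
      destruct (next_ex x) as [b Hb]; [apply (Hpv i x Hx)|].
      assert (Hb' := Hb); destruct Hb' as (_ & (_ & f & Hf & Hd) & _).
      exists f; apply HA; split; [apply Hf|exists x, b; auto].
    + intros f Hf; destruct (Hin i A f HA Hf) as (x & b & _ & _ & (HfW & L & _) & _).
      split; [exact (bounded_ord f HfW)|].
      apply lt_mod_large; auto; [apply (bounded_ord f HfW)|apply large_E, L].
  - intros i j A B f g Hij HA HB Hf Hg.
    destruct (Hin i A f HA Hf) as (x & b & Hx & Hb & (HfW & _) & Hd).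
    destruct (Hin j B g HB Hg) as (y & e & Hy & _ & Hyg & _).
    apply lt_mod_large; auto; [apply (bounded_ord f HfW)|].
    apply (ranked_dominated f b y g Hd Hyg).
    destruct (Hpv j y Hy) as [_ K]; destruct (K i Hij) as [_ (x' & b' & Hx' & Hb' & Hle')].
    rewrite (app_func p c i x' x Hp Hx' Hx) in Hb'.
    rewrite (next_unique x b b' Hb Hb'); exact Hle'.
  - intros f Hf L; apply lt_mod_large in L; auto; [|apply Hf].
    destruct (dominated_ex f Hf L) as (b & Hb & Hd).
    destruct (Hcof b Hb) as (i & u & Hu & Hbu).
    destruct (proj2 (proj2 Lc) i (app_dom h c i u (proj1 Hh) Hu)) as (j & Hj & Hij).
    destruct (app_ex F c j HF Hj) as [A HA].
    exists j, A; split; [exact HA|]; intros g Hg.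
    apply lt_mod_large; auto; [apply Hf|].
    destruct (Hin j A g HA Hg) as (y & e & Hy & _ & Hyg & _).
    apply (ranked_dominated f b y g Hd Hyg).
    destruct (Hpv j y Hy) as [Hyd K]; destruct (K i Hij) as [(u' & Hu' & Huy) _].
    rewrite (app_func h c i u' u (proj1 Hh) Hu' Hu) in Huy.
    exact (ord_le_trans b u y (ord_elem delta y Odelta Hyd) Hbu Huy).
Qed.

(** Send [i] in [g] to the least ordinal from which on some function of level [i]
    is dominated.  These ordinals have a bound [x] in [delta], and a function
    [k] of rank at least [x] is above a member of every level.  But [k] is below
    all members of some level. *)
Lemma pstcf_minimal g : g ∈ c -> ~ has_pstcf Y E alpha g.
Proof.
  intros Hg (_ & F & HF & HFv & _ & HFcof).
  destruct (cof_not_le g Hg) as [Og Ng].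
  pose (bnd := fun i b => b ∈ delta /\ exists A f, app F i A /\ f ∈ A /\ dominated f b).
  assert (Hbnd : forall i, i ∈ g -> exists b, least_ord (bnd i) b).
  { intros i Hi; destruct (app_ex F g i HF Hi) as [A HA].
    destruct (HFv i A HA) as ([f Hf] & Hall).
    destruct (Hall f Hf) as [Of Lf]; apply lt_mod_large in Lf; auto; [|apply Of].
    destruct (dominated_ex f Of Lf) as (b & Hb & Hd).
    destruct (least_ord_ex (bnd i) b) as (m & Hm & _).
    - unfold bnd; definable.
    - exact (ord_elem delta b Odelta Hb).
    - split; [exact Hb|eauto].
    - exists m; exact Hm. }
  destruct (not_cofinal g (fun i b => least_ord (bnd i) b)) as (x & Hx & K); auto.
  - unfold bnd; definable.
  - intros i b b' _; apply least_ord_unique.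
  - intros i b _ Hb; apply Hb.
  - destruct (ranked_from_ex x Hx) as [k Hk].
    assert (Ok : ord_fun Y k) by apply bounded_ord, Hk.
    destruct (HFcof k Ok) as (i & A & HA & HkA).
    { apply lt_mod_large; auto; [apply Ok|apply large_E, Hk]. }
    destruct (HFv i A HA) as [_ Hall].
    assert (Hi := app_dom F g i A HF HA).
    destruct (Hbnd i Hi) as [b Hb].
    assert (Hbx := K i b Hi Hb).
    destruct Hb as (_ & (_ & A' & f & HA' & Hf & Hd) & _).
    rewrite (app_func F g i A' A HF HA' HA) in Hf.
    destruct (Hall f Hf) as [Of _].
    assert (L1 := HkA f Hf); apply lt_mod_large in L1; auto; [|apply Ok].
    assert (L2 := ranked_dominated f b x k Hd Hk (or_introl Hbx)).
    destruct (large_inhabited Y E _ FE (large_and Y E _ _ FE L1 L2))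
      as (s & _ & _ & (u & v & Hu & Hv & Huv) & (v' & u' & Hv' & Hu' & Hvu)).
    rewrite (app_func f Y s v' v (proj1 Of) Hv' Hv) in Hvu.
    rewrite (app_func k Y s u' u (proj1 Ok) Hu' Hu) in Hvu.
    exact (mem_asym u v Huv Hvu).
Qed.

Lemma agreement_pstcf : is_pstcf Y E alpha c.
Proof.
  split; [exact cof_ord|split; [exact pstcf_cof|exact pstcf_minimal]].
Qed.

End Rank.
End SetTheory.

Theorem claim5p9 (M : eps_struct) (hZF : ZF M) (hDC : DC M)
  (kappa omega : M) (homega : is_omega omega)
  (hkappa : is_cardinal kappa) (hkappa_gt : omega ∈ kappa)
  (hAC : AC_lt kappa)
  (Y D alpha : M)
  (hD : complete_filter kappa Y D)
  (halpha : ord_fun Y alpha)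
  (delta c Fil theta : M)
  (hdelta : is_rank Y D alpha delta)
  (hc : is_cof delta c)
  (hFil : is_Fil1 kappa Y Fil)
  (htheta : is_theta Fil theta)
  (hle : ord_le theta c) :
  exists D' : M,
    complete_filter kappa Y D' /\
    subset D D' /\
    (exists gamma : M, has_pstcf Y D' alpha gamma) /\
    is_pstcf Y D' alpha c.
Proof.
  destruct hdelta as (_ & Odelta & R & HR & Hrec & Rdelta).
  assert (Okappa : is_ord kappa) by apply hkappa.
  destruct (bounded_functions hZF Y alpha halpha) as [W HW].
  destruct (agreement_ex hZF Y D alpha R HR W delta) as [E HE].
  exists E; split; [|split; [|assert (Htcf : is_pstcf Y E alpha c); [|split]]].
  - exact (agreement_complete hZF kappa Y D alpha R Okappa hAC hD halpha HR Hrec W HW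
      delta Odelta Rdelta E HE omega homega hkappa_gt).
  - exact (agreement_extends kappa Y D alpha R hD halpha W HW delta Rdelta E HE).
  - exact (agreement_pstcf hZF kappa Y D alpha R Okappa hAC hD halpha HR Hrec W HW
      delta Odelta Rdelta E HE omega homega hkappa_gt c hc Fil theta hFil htheta hle).
  - exists c; apply Htcf.
  - exact Htcf.
Qed.
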